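(* Let $A_C\in\mathbb{R}^{n\times n}$ be a companion matrix with characteristic polynomial $N(s)$ and simple spectrum $\lambda_1,\dots,\lambda_n$ satisfying $\lambda_i+\lambda_j\neq0$ for all $i,j$. Then the spectral decompositions (over the eigenvalues of $A_C$) of the finite controllability Gramian $P_C(t)$ and its inverse $P_C^{-1}(t)$, satisfying respectively the differential Lyapunov equation $$-\frac{dP_C(t)}{dt}+A_CP_C(t)+P_C(t)A_C^T=-e_ne_n^T,$$ the differential Riccati equation $$\frac{dP_C^{-1}}{dt}+P_C^{-1}A_C+A_C^TP_C^{-1}=-P_C^{-1}e_ne_n^TP_C^{-1},$$ and the boundary condition $P_C(0)=P_0$, take the following form: $$P_C(t)=P_C(\infty)+\sum_{i=1}^n\left(R_iP_0-\hat P_i^C\right)e^{(\lambda_iI+A_C^T)t},\qquad P_C^{-1}(t)=G(t)\sum_{j=1}^n\hat P_j^{-C},$$ where $$P_C(\infty)=\sum_{i=1}^n\hat P_i^C,\qquad P_C^{-1}(\infty)=\sum_{j=1}^n\hat P_j^{-C},$$ $$\hat P_i^C=\frac{x_ix_i^T\mathcal{J}}{-N'(\lambda_i)N(-\lambda_i)},\qquad \hat P_j^{-C}=\frac{\mathcal{J}y_jy_j^TN(-\lambda_j)}{-N'(\lambda_j)},$$ and $G(t)$ is the normalization matrix given by $$G^{-1}(t)=I-e^{(A_C^T+\mathcal{J}A_C^T\mathcal{J})t}+\sum_{i=1}^n\hat P_i^{-C}P_0\,e^{(\lambda_iI+A_C^T)t}.$$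
   Context: The companion matrix is $A_C=\begin{bmatrix}0_{(n-1)\times 1}&I_{(n-1)\times(n-1)}\\-a_0&-a_1\ \cdots\ -a_{n-1}\end{bmatrix}$ with real $a_0,\dots,a_{n-1}$, so $N(s)=\det(sI-A_C)=\sum_{k=0}^na_ks^k$ with $a_n=1$, and $N'$ is its derivative; $e_n=[0,\dots,0,1]^T$. Put $x_i=[1,\lambda_i,\dots,\lambda_i^{n-1}]^T$ and $y_i=\lambda_i^{-n}\mathcal{H}_lx_i$, where $\mathcal{H}_l$ is the $n\times n$ lower Hankel matrix with $(\mathcal{H}_l)_{rc}=a_{r+c-n-1}$ if $r+c\ge n+1$ and $0$ otherwise (so $A_Cx_i=\lambda_ix_i$ and $y_i^TA_C=\lambda_iy_i^T$), and $R_i=\dfrac{x_iy_i^T}{-N'(\lambda_i)}$. $\mathcal{J}=\mathrm{diag}(-1,(-1)^2,\dots,(-1)^n)$. $P_0$ is an $n\times n$ matrix. $P_C(\infty)$ denotes the solution of the algebraic Lyapunov equation $A_CP+PA_C^T=-e_ne_n^T$, and $P_C^{-1}(\infty)$ its inverse, which solves the algebraic Riccati equation $P^{-1}A_C+A_C^TP^{-1}=-P^{-1}e_ne_n^TP^{-1}$; stability of $A_C$ is not required.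
   Formalization: In G^{-1}(t) the term e^{(A_C^T+JA_C^TJ)t} is replaced by the ordered product e^{JA_C^TJt}e^{A_C^Tt}; as printed the formula fails for n≥2 (e.g. P_0=P_C(∞)), since the two exponents do not commute; for n=1 both agree. *)

(* Defs.v *)
(* MathComp and MathComp-Analysis; complex numbers are R[i] for R : realType,
   with the topology that every numFieldType carries. *)
From HB Require Import structures.
From mathcomp Require Export all_boot all_order all_algebra.
From mathcomp Require Export all_classical all_reals all_analysis.
From mathcomp.real_closed Require Export complex.
Export Order.TTheory GRing.Theory Num.Theory numFieldNormedType.Exports.

Set Implicit Arguments.
Unset Strict Implicit.
Unset Printing Implicit Defensive.

Open Scope classical_set_scope.
Open Scope ring_scope.
Open Scope complex_scope.

(* Matrices have size n.+1; rows, columns and eigenvalues are indexed from 0,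
   and the tuple a lists the coefficients a_0, ..., a_n of the characteristic
   polynomial below its leading monomial of degree n.+1. *)

Definition companion (K : nzRingType) (n : nat) (a : n.+1.-tuple K) :
    'M[K]_n.+1 :=
  \matrix_(r, c) (if r == ord_max then - a`_c else (c == r.+1 :> nat)%:R).

Definition lower_hankel (K : nzRingType) (n : nat) (a : n.+1.-tuple K) :
    'M[K]_n.+1 :=
  \matrix_(r, c) (if (n <= r + c)%N then a`_(r + c - n) else 0).

(* diag (-1, (-1)^2, ..., (-1)^(n+1)) *)
Definition altJ (K : nzRingType) (n : nat) : 'M[K]_n.+1 :=
  diag_mx (\row_(j < n.+1) (-1) ^+ j.+1).

(* limn is only meaningful for convergent sequences; over R and R[i] this
   series converges for every M. *)
Definition expmx (K : numFieldType) (n : nat) (M : 'M[K]_n.+1) : 'M[K]_n.+1 :=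
  limn (series (fun k : nat => k`!%:R^-1 *: M ^+ k)).

(* R[i] is not a normed module over R in the library, so is_derive does not
   apply to complex-valued functions of a real variable. *)
Definition is_mx_derive (R : realType) (n : nat) (F : R -> 'M[R[i]]_n.+1)
    (t : R) (dF : 'M[R[i]]_n.+1) : Prop :=
  (fun h : R => (h%:C)^-1 *: (F (t + h) - F t)) @ (0 : R)^'
    --> (dF : 'M[R[i] : numFieldType]_n.+1).

(* F solves on the interval D the differential equation expressed by the
   relation E between the value and the derivative of F: one-sided behaviour
   at the end points of D is only constrained by continuity. *)
Definition solves_ode (R : realType) (n : nat) (D : interval R)
    (E : 'M[R[i]]_n.+1 -> 'M[R[i]]_n.+1 -> Prop)
    (F : R -> 'M[R[i]]_n.+1) : Prop :=
  {within [set` D],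
     continuous (F : R -> 'M[R[i] : numFieldType]_n.+1)} /\
  forall t : R, [set` D]^° t -> exists2 dF, is_mx_derive F t dF & E (F t) dF.

Section Companion.
Context {R : realType} {n : nat} (a : n.+1.-tuple R).

Definition AC : 'M[R[i]]_n.+1 := map_mx (real_complex R) (companion a).

Definition Npoly : {poly R[i]} := char_poly AC.

(* e_n e_n^T, for the last vector e_n of the canonical basis *)
Definition eeT : 'M[R[i]]_n.+1 :=
  let e : 'cV[R[i]]_n.+1 := delta_mx ord_max 0 in e *m e^T.

Definition xvec (z : R[i]) : 'cV[R[i]]_n.+1 := \col_r z ^+ r.

Definition yvec (z : R[i]) : 'cV[R[i]]_n.+1 :=
  z ^- n.+1 *: (map_mx (real_complex R) (lower_hankel a) *m xvec z).

Definition residue (z : R[i]) : 'M[R[i]]_n.+1 :=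
  (- Npoly^`().[z])^-1 *: (xvec z *m (yvec z)^T).

Definition gram_part (z : R[i]) : 'M[R[i]]_n.+1 :=
  (- Npoly^`().[z] * Npoly.[- z])^-1 *: (xvec z *m (xvec z)^T *m altJ _ n).

Definition invgram_part (z : R[i]) : 'M[R[i]]_n.+1 :=
  (Npoly.[- z] / - Npoly^`().[z]) *: (altJ _ n *m yvec z *m (yvec z)^T).

Definition lyapunov_alg (X : 'M[R[i]]_n.+1) : Prop :=
  AC *m X + X *m AC^T = - eeT.

Definition riccati_alg (Y : 'M[R[i]]_n.+1) : Prop :=
  Y *m AC + AC^T *m Y = - (Y *m eeT *m Y).

Definition lyapunov_diff (X dX : 'M[R[i]]_n.+1) : Prop :=
  - dX + AC *m X + X *m AC^T = - eeT.

Definition riccati_diff (Y dY : 'M[R[i]]_n.+1) : Prop :=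
  dY + Y *m AC + AC^T *m Y = - (Y *m eeT *m Y).

End Companion.

(* Main.v *)
Require Import Defs.
From mathcomp Require Import perm ring lra.

(** Write N for the characteristic polynomial, x_i and y_i for the vectors
    attached to the eigenvalue l_i, and Q_j for the summands of the inverse
    Gramian.

    Algebra. The entries of y_i are the coefficients of - N / ('X - l_i)
    ([ypoly_factor]).  Hence y_i^T x_j vanishes for i <> j and equals
    - N'(l_i) for i = j, so the residues R_i are orthogonal idempotents; they
    sum to the identity because a left inverse of a square matrix is a right
    inverse ([sum_residue]).  Since A x(w) = w x(w) - N(w) e_n and
    J x(w) = - x(- w), the summands P_i of the algebraic solution satisfy
    A P_i + P_i A^T = - x_i e_n^T / N'(l_i) = - R_i e_n e_n^T, and summing gives
    the algebraic Lyapunov equation ([lyapunov_sum_gram]).  Its solution is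
    unique because compressing A X + X A^T = 0 by R_i and R_j^T multiplies
    R_i X R_j^T by l_i + l_j, which is nonzero ([sylvester_eq0]).
    The same orthogonality gives (sum_j Q_j)(sum_i P_i) = 1.

    Differential Lyapunov equation.  As A multiplies each coefficient
    R_i P_0 - P_i by l_i, the proposed P_C(t) differentiates to the right
    value ([mxderive_eigen_sum]); it starts at P_0 because the R_i sum to 1.
    Two solutions with the same initial value differ by a solution of a
    homogeneous linear equation that vanishes at 0, hence vanishes identically
    ([linear_ode_eq0], from Gronwall's inequality).

    Inverse.  The matrix G^-1(t) is P_C(oo)^-1 P_C(t) ([inv_normalizerE]).  The
    only term for which this is not immediate is the product of exponentials,
    and both of its expressions solve F' = J A^T J F + F A^T, F(0) = 1.

    Differential Riccati equation.  If Q solves it, then E = Q P_C - 1 solves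
    E' = (- A^T - Q e_n e_n^T) E + E A^T with E(0) = 0, so E = 0: the Gramian
    cannot become singular while Q exists.  Conversely, the inverse of P_C is
    differentiable by Cramer's rule, and differentiating Q P_C = 1 gives the
    Riccati equation. *)

Set Implicit Arguments.
Unset Strict Implicit.
Unset Printing Implicit Defensive.

(** * Limits of complex matrices, read on real and imaginary parts *)

Section ComplexAnalysis.
Context {R : realType}.
Local Notation C := (R[i] : numFieldType).
Local Notation Re := (@complex.Re _).
Local Notation Im := (@complex.Im _).

Lemma ReD (z w : R[i]) : Re (z + w) = Re z + Re w.
Proof. by case: z w => [? ?] [? ?]. Qed.

Lemma ImD (z w : R[i]) : Im (z + w) = Im z + Im w.
Proof. by case: z w => [? ?] [? ?]. Qed.

Lemma ReN (z : R[i]) : Re (- z) = - Re z.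
Proof. by case: z => [? ?]. Qed.

Lemma ImN (z : R[i]) : Im (- z) = - Im z.
Proof. by case: z => [? ?]. Qed.

Lemma ReM (z w : R[i]) : Re (z * w) = Re z * Re w - Im z * Im w.
Proof. by case: z w => [? ?] [? ?]. Qed.

Lemma ImM (z w : R[i]) : Im (z * w) = Re z * Im w + Im z * Re w.
Proof. by case: z w => [? ?] [? ?]. Qed.

Lemma normc_ge_Im (z : R[i]) : `|Im z|%:C <= `|z|.
Proof.
have := normc_ge_Re (z * 'i%C); rewrite ReiNIm normrN normrM.
by rewrite [`|'i%C|]normc_def /= expr0n expr1n add0r sqrtr1 mulr1.
Qed.

Lemma normc_le_ReIm (z : R[i]) : `|z| <= (`|Re z| + `|Im z|)%:C.
Proof.
rewrite normc_def lecR -[leRHS]ger0_norm ?addr_ge0// -sqrtr_sqr.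
rewrite ler_wsqrtr// sqrrD !real_normK ?num_real// lerD2r lerDl.
by rewrite mulrn_wge0 ?mulr_ge0.
Qed.

Lemma cvg_complexP (T : Type) (F : set_system T) (FF : Filter F)
    (f : T -> C) (l : C) :
  f @ F --> l <->
  (fun x => Re (f x)) @ F --> (Re l : R) /\
  (fun x => Im (f x)) @ F --> (Im l : R).
Proof.
split.
  move=> /cvgrPdist_lt fl; split; apply/cvgrPdist_lt => e e0;
    (have := fl e%:C; rewrite ltcR => /(_ e0); apply: filterS => x fx;
     rewrite -ltcR; apply: le_lt_trans fx).
    by rewrite -ReN -ReD normc_ge_Re.
  by rewrite -ImN -ImD normc_ge_Im.
move=> [/cvgrPdist_lt fr /cvgrPdist_lt fi]; apply/cvgrPdist_lt => e e0.
have [d d0 ->] : exists2 d : R, 0 < d & e = d%:C.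
  case: e e0 => x y; rewrite ltcE /= => /andP[/eqP -> x0].
  by exists x.
have d2 : 0 < d / 2 by rewrite divr_gt0.
near=> x.
apply: le_lt_trans (normc_le_ReIm _) _.
rewrite ltcR [d]splitr ReD ImD ReN ImN ltrD//.
- by near: x; exact: fr.
- by near: x; exact: fi.
Unshelve. all: by end_near. Qed.

(** The bridge to real analysis: limits, continuity on an interval and
    derivatives of complex matrices are all instances of it, for different
    filters. *)
Lemma cvg_complex_mxP (T : Type) (F : set_system T) (FF : Filter F) (m n : nat)
    (f : T -> 'M[C]_(m, n)) (l : 'M[C]_(m, n)) :
  f @ F --> l <->
  forall i j,
  (fun x => Re (f x i j)) @ F --> (Re (l i j) : R) /\
  (fun x => Im (f x i j)) @ F --> (Im (l i j) : R).
Proof.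
split.
  move=> fl i j; apply/cvg_complexP.
  move=> A /= lA.
  apply: (fl [set M | A (M i j)]).
  pose P i' j' : set C := if (i' == i) && (j' == j) then A else setT.
  exists P => [i' j'|M /(_ i j)]; last by rewrite /P !eqxx.
  by rewrite /P; case: ifP => [/andP[/eqP -> /eqP ->]//|_]; exact: filterT.
move=> fl A [P lP PA].
have {}fl i j : F [set x | P i j (f x i j)].
  by have /cvg_complexP := fl i j; apply; exact: lP.
have Fall : F [set x | forall ij, P ij.1 ij.2 (f x ij.1 ij.2)].
  by apply: filter_forall => -[i j]; exact: fl.
suff sub : [set x | forall ij, P ij.1 ij.2 (f x ij.1 ij.2)] `<=` f @^-1` A.
  exact: (filterS sub Fall).
by move=> x Px; apply: PA => i j; exact: (Px (i, j)).
Qed.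

Lemma cvg_bigsum (K : numFieldType) (T I : Type) (F : set_system T)
    (FF : Filter F) (r : seq I) (f : I -> T -> K) (l : I -> K) :
  (forall i, f i @ F --> l i) ->
  (fun x => \sum_(i <- r) f i x) @ F --> \sum_(i <- r) l i.
Proof.
move=> fl; elim: r => [|i r IH].
  by rewrite big_nil; under eq_fun do rewrite big_nil; exact: cvg_cst.
rewrite big_cons; under eq_fun do rewrite big_cons.
exact: cvgD.
Qed.

Lemma cvg_mxP (T : Type) (F : set_system T) (FF : Filter F) (m n : nat)
    (f : T -> 'M[C]_(m, n)) (l : 'M[C]_(m, n)) :
  f @ F --> l <-> forall i j, (fun x => f x i j) @ F --> l i j.
Proof.
rewrite cvg_complex_mxP; split => fl i j; last by apply/cvg_complexP; exact: fl.
by apply/cvg_complexP; exact: fl.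
Qed.

Lemma cvg_mulmx (T : Type) (F : set_system T) (FF : Filter F) (m n p : nat)
    (f : T -> 'M[C]_(m, n)) (g : T -> 'M[C]_(n, p))
    (A : 'M[C]_(m, n)) (B : 'M[C]_(n, p)) :
  f @ F --> A -> g @ F --> B -> (fun x => f x *m g x) @ F --> A *m B.
Proof.
move=> /cvg_mxP fA /cvg_mxP gB; apply/cvg_mxP => i j; rewrite mxE.
under eq_fun do rewrite mxE.
by apply: cvg_bigsum => k; apply: cvgM; [exact: fA|exact: gB].
Qed.

(** * Gronwall's inequality *)

Lemma is_derive1D (f g : R -> R) (t df dg : R) :
  is_derive t 1 f df -> is_derive t 1 g dg ->
  is_derive t 1 (fun s => f s + g s) (df + dg).
Proof. by move=> fd gd; exact: (@is_deriveD R R R f g t 1 df dg fd gd). Qed.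

Lemma is_derive1V (f : R -> R) (t df : R) : f t != 0 ->
  is_derive t 1 f df -> is_derive t 1 (fun s => (f s)^-1) (- f t ^- 2 * df).
Proof. by move=> f0 fd; exact: (@is_deriveV R f t df 1 f0 fd). Qed.

Lemma is_derive1_ext (f g : R -> R) (t df dg : R) :
  f =1 g -> df = dg -> is_derive t 1 f df -> is_derive t 1 g dg.
Proof. by move=> /funext -> ->. Qed.

Lemma is_derive1N (f : R -> R) (t df : R) :
  is_derive t 1 f df -> is_derive t 1 (fun s => - f s) (- df).
Proof. by move=> fd; exact: (@is_deriveN R R R f t 1 df fd). Qed.

Lemma is_derive1M (f g : R -> R) (t df dg : R) :
  is_derive t 1 f df -> is_derive t 1 g dg ->
  is_derive t 1 (fun s => f s * g s) (df * g t + f t * dg).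
Proof.
move=> fd gd; have := @is_deriveM R R f g t 1 df dg fd gd.
by rewrite /GRing.scale/= addrC [g t * _]mulrC.
Qed.

Lemma is_derive1_bigsum (I : Type) (r : seq I) (f : I -> R -> R) (t : R) d :
  (forall i, is_derive t 1 (f i) (d i)) ->
  is_derive t 1 (fun s => \sum_(i <- r) f i s) (\sum_(i <- r) d i).
Proof.
move=> fd; elim: r => [|i r IH].
  rewrite big_nil; under [X in is_derive _ _ X]eq_fun do rewrite big_nil.
  exact: is_derive_cst.
rewrite big_cons; under [X in is_derive _ _ X]eq_fun do rewrite big_cons.
exact: is_deriveD.
Qed.

Lemma continuous_bigsum (T : topologicalType) (I : Type) (r : seq I)
    (f : I -> T -> R) :
  (forall i, continuous (f i)) -> continuous (fun s => \sum_(i <- r) f i s).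
Proof. by move=> fc x; apply: cvg_bigsum => i; exact: fc. Qed.

(** The hypothesis makes u(s) exp(- C s) nonincreasing and u(s) exp(C s)
    nondecreasing, so a nonpositive value at the left end propagates to the
    right and one at the right end propagates to the left. *)
Lemma gronwall_le0 (u du : R -> R) (C a b : R) :
  a <= b -> {within `[a, b], continuous u} ->
  (forall x, x \in `]a, b[ -> is_derive x 1 u (du x)) ->
  (forall x, x \in `]a, b[ -> `|du x| <= C * u x) ->
  (u a <= 0 \/ u b <= 0) ->
  forall x, x \in `[a, b] -> u x <= 0.
Proof.
move=> ab uc ud duC u0.
have ec (c : R) : {within `[a, b], continuous (fun s : R => expR (c * s))}.
  apply: continuous_subspaceT => x; apply: continuous_comp.
    exact: mulrl_continuous.
  exact: continuous_expR.
have vc c : {within `[a, b], continuous (fun s => u s * expR (c * s))}.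
  move=> x; apply: (@continuousM R (subspace `[a, b]) u (fun s => expR (c * s))).
    exact: uc.
  exact: ec.
have vd c x : x \in `]a, b[ ->
    is_derive x 1 (fun s => u s * expR (c * s))
      ((du x + c * u x) * expR (c * x)).
  move=> /ud dux.
  have de : is_derive x 1 (fun s => expR (c * s)) (expR (c * x) * c).
    apply: (@is_derive1_comp _ expR (fun s => c * s)).
    rewrite -[X in is_derive _ _ _ X]mulr1.
    by have := @is_deriveZ _ _ _ id c x 1 1 _; apply.
  have := is_derive1M dux de; congr is_derive; ring.
have ain : a \in `[a, b] by rewrite in_itv /= lexx.
have bin : b \in `[a, b] by rewrite in_itv /= ab lexx.
move=> x xab; move: (xab); rewrite in_itv /= => /andP[ax xb].
case: u0 => u0.
- have := @ler0_derive1_le_cc _ (fun s => u s * expR (- C * s)) a b _ _ (vc _)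
    x a xab ain ax.
  have H y : y \in `]a, b[ -> derivable (fun s => u s * expR (- C * s)) y 1.
    by move=> /(vd (- C)) [].
  move=> /(_ H) => {}H; rewrite -(pmulr_lle0 _ (expR_gt0 (- C * x))).
  apply: le_trans (H _) _.
    move=> y yab; rewrite derive1E (derive_val (is_derive := vd (- C) y yab)).
    rewrite pmulr_lle0 ?expR_gt0// mulNr subr_le0.
    by apply: le_trans (duC _ yab); exact: ler_norm.
  by rewrite pmulr_lle0 ?expR_gt0.
- have := @ger0_derive1_le_cc _ (fun s => u s * expR (C * s)) a b _ _ (vc _)
    x b xab bin xb.
  have H y : y \in `]a, b[ -> derivable (fun s => u s * expR (C * s)) y 1.
    by move=> /(vd C) [].
  move=> /(_ H) => {}H; rewrite -(pmulr_lle0 _ (expR_gt0 (C * x))).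
  apply: le_trans (H _) _.
    move=> y yab; rewrite derive1E (derive_val (is_derive := vd C y yab)).
    rewrite pmulr_lge0 ?expR_gt0// -lerBlDr sub0r lerNl.
    by apply: le_trans (duC _ yab); rewrite -normrN ler_norm.
  by rewrite pmulr_lle0 ?expR_gt0.
Qed.

(** Gronwall's inequality applied to the sum of squares, whose derivative is
    controlled through 2 |f_j| |f_k| <= f_j^2 + f_k^2. *)
Lemma gronwall_eq0 (I : finType) (f df : I -> R -> R) (K a b : R) :
  a <= b -> 0 <= K ->
  (forall i, {within `[a, b], continuous (f i)}) ->
  (forall i x, x \in `]a, b[ -> is_derive x 1 (f i) (df i x)) ->
  (forall i x, x \in `]a, b[ -> `|df i x| <= K * \sum_j `|f j x|) ->
  (forall i, f i a = 0) \/ (forall i, f i b = 0) ->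
  forall i x, x \in `[a, b] -> f i x = 0.
Proof.
move=> ab K0 fc fd dfK f0 i x xab.
pose u s := \sum_j f j s * f j s.
have ge0 s j : 0 <= f j s * f j s by rewrite -expr2 sqr_ge0.
suff : u x <= 0.
  move=> ux; have : u x == 0 by rewrite eq_le ux sumr_ge0.
  rewrite psumr_eq0// => /allP /(_ i); rewrite mem_index_enum => /(_ isT).
  by rewrite mulf_eq0 orbb => /eqP.
pose du s := \sum_j (df j s * f j s + f j s * df j s).
apply: (@gronwall_le0 u du (2 * (#|I|)%:R * K) a b ab) => //.
- apply: continuous_bigsum => j y.
  by apply: (@continuousM R (subspace `[a, b]) (f j) (f j)); exact: fc.
- move=> y yab; apply: is_derive1_bigsum => j.
  exact: (is_derive1M (fd j y yab) (fd j y yab)).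
- move=> y yab; apply: le_trans (ler_norm_sum _ _ _) _.
  apply: (@le_trans _ _ (\sum_j \sum_k (K * (f j y * f j y + f k y * f k y)))).
    apply: ler_sum => j _.
    rewrite [df j y * _]mulrC -mulr2n normrMn normrM -mulr_sumr.
    have := ler_wpM2l (normr_ge0 (f j y)) (dfK j y yab).
    move=> /(ler_wMn2r 2) /le_trans; apply.
    rewrite mulrCA -mulrnAr ler_wpM2l// mulr_sumr -sumrMnl ler_sum// => k _.
    have := sqr_ge0 (`|f j y| - `|f k y|).
    have : `|f j y| ^+2 = f j y * f j y by rewrite real_normK ?num_real.
    have : `|f k y| ^+2 = f k y * f k y by rewrite real_normK ?num_real.
    by rewrite !expr2 => <- <-; lra.
  have -> : \sum_j \sum_k (K * (f j y * f j y + f k y * f k y)) =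
      2 * #|I|%:R * K * u y.
    under eq_bigr do rewrite -mulr_sumr big_split /= sumr_const cardT -cardE.
    rewrite -mulr_sumr big_split /= sumr_const sumrMnl cardT -cardE -/(u y).
    by rewrite -[u y *+ _]mulr_natl; ring.
  exact: lexx.
- by case: f0 => f0; [left|right]; rewrite /u big1// => j _; rewrite f0 mul0r.
Qed.

(** * Derivatives of complex matrix-valued functions of a real variable *)

Lemma is_derive1_cvgP (g : R -> R) (t d : R) :
  is_derive t 1 g d <->
  (fun h => h^-1 * (g (t + h) - g t)) @ (0 : R)^' --> d.
Proof.
have E : (fun h => h^-1 * (g (t + h) - g t)) =
    (fun h => h^-1 *: ((g \o shift t) (h *: (1 : R)) - g t)).
  by apply/funext => h /=; rewrite [h *: 1]mulr1 [t + h]addrC.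
rewrite E; split=> [[dg <-]|dg]; first exact: dg.
by apply: DeriveDef; [apply/cvg_ex; exists d | exact: cvg_lim].
Qed.

(** Complex-valued functions are differentiated through their real and
    imaginary parts, where the calculus of real functions applies. *)
Definition cderive (f : R -> R[i]) (t : R) (d : R[i]) : Prop :=
  is_derive t 1 (fun s => Re (f s)) (Re d) /\
  is_derive t 1 (fun s => Im (f s)) (Im d).

Definition mxderive (m n : nat) (F : R -> 'M[R[i]]_(m, n)) (t : R)
    (dF : 'M[R[i]]_(m, n)) : Prop :=
  forall i j, cderive (fun s => F s i j) t (dF i j).

Lemma is_mx_deriveP n (F : R -> 'M[R[i]]_n.+1) (t : R) dF :
  is_mx_derive F t dF <-> mxderive F t dF.
Proof.
have E h i j : Re (((h%:C)^-1 *: (F (t + h) - F t)) i j) =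
       h^-1 * (Re (F (t + h) i j) - Re (F t i j)) /\
     Im (((h%:C)^-1 *: (F (t + h) - F t)) i j) =
       h^-1 * (Im (F (t + h) i j) - Im (F t i j)).
  rewrite !mxE -fmorphV/= ReM ImM ReD ImD ReN ImN /=.
  by rewrite !mul0r subr0 addr0.
rewrite /is_mx_derive cvg_complex_mxP; split => dFt i j.
  have [dr di] := dFt i j; split; apply/is_derive1_cvgP.
    by apply: cvg_trans dr; apply: near_eq_cvg; near=> h; rewrite (E h i j).1.
  by apply: cvg_trans di; apply: near_eq_cvg; near=> h; rewrite (E h i j).2.
have [/is_derive1_cvgP dr /is_derive1_cvgP di] := dFt i j; split.
  by apply: cvg_trans dr; apply: near_eq_cvg; near=> h; rewrite (E h i j).1.
by apply: cvg_trans di; apply: near_eq_cvg; near=> h; rewrite (E h i j).2.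
Unshelve. all: by end_near. Qed.

Lemma cderive_unique f t d d' : cderive f t d -> cderive f t d' -> d = d'.
Proof.
move=> [[_ r] [_ i]] [[_ r'] [_ i']]; apply/eqP.
by rewrite eq_complex -r -r' -i -i' !eqxx.
Qed.

Lemma cderive_near f g t d :
  (\forall s \near t, f s = g s) -> cderive f t d -> cderive g t d.
Proof.
move=> fg [fr fi]; split; [move: fr|move: fi]; apply: near_eq_is_derive;
  by apply: filterS fg => s /= ->.
Qed.

Lemma cderive_cst c t : cderive (fun=> c) t 0.
Proof. by split; exact: is_derive_cst. Qed.

Lemma cderiveD f g t df dg :
  cderive f t df -> cderive g t dg -> cderive (fun s => f s + g s) t (df + dg).
Proof.
move=> [fr fi] [gr gi]; split.
  by apply: is_derive1_ext (is_derive1D fr gr) => [s|]; rewrite ReD.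
by apply: is_derive1_ext (is_derive1D fi gi) => [s|]; rewrite ImD.
Qed.

Lemma cderiveM f g t df dg : cderive f t df -> cderive g t dg ->
  cderive (fun s => f s * g s) t (df * g t + f t * dg).
Proof.
move=> [fr fi] [gr gi]; split.
  apply: is_derive1_ext
    (is_derive1D (is_derive1M fr gr) (is_derive1N (is_derive1M fi gi))) => [s|].
    by rewrite ReM.
  by rewrite ReD !ReM; ring.
apply: is_derive1_ext
  (is_derive1D (is_derive1M fr gi) (is_derive1M fi gr)) => [s|].
  by rewrite ImM.
by rewrite ImD !ImM; ring.
Qed.

Lemma cderive_sum (I : Type) (r : seq I) (P : pred I) (f : I -> R -> R[i]) t d :
  (forall i, cderive (f i) t (d i)) ->
  cderive (fun s => \sum_(i <- r | P i) f i s) t (\sum_(i <- r | P i) d i).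
Proof.
move=> fd; elim: r => [|i r IH].
  rewrite big_nil; under [X in cderive X]eq_fun do rewrite big_nil.
  exact: cderive_cst.
rewrite big_cons; under [X in cderive X]eq_fun do rewrite big_cons.
by case: (P i) => //; exact: cderiveD.
Qed.

(** * Uniqueness for linear matrix differential equations *)

Lemma within_continuous_mxP (m n : nat) (D : set R) (F : R -> 'M[C]_(m, n)) :
  {within D, continuous F} <->
  forall i j, {within D, continuous (fun s => Re (F s i j))} /\
              {within D, continuous (fun s => Im (F s i j))}.
Proof.
split=> [Fc i j|Fc x].
  by split=> x; have /cvg_complex_mxP /(_ i j)[] := Fc x.
apply/cvg_complex_mxP => i j.
by have [/(_ x) ? /(_ x) ?] := Fc i j.
Qed.

(** A real-valued norm, so that bounds on complex entries can be fed to real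
    estimates without leaving the reals. *)
Definition l1norm (z : R[i]) : R := `|Re z| + `|Im z|.

Lemma l1norm_ge0 z : 0 <= l1norm z. Proof. by rewrite addr_ge0. Qed.

Lemma l1normD z w : l1norm (z + w) <= l1norm z + l1norm w.
Proof.
by rewrite /l1norm ReD ImD addrACA lerD// ler_normD.
Qed.

Lemma l1norm_sum (I : Type) (r : seq I) (f : I -> R[i]) :
  l1norm (\sum_(i <- r) f i) <= \sum_(i <- r) l1norm (f i).
Proof.
elim: r => [|i r IH]; first by rewrite !big_nil /l1norm /= normr0 addr0.
by rewrite !big_cons (le_trans (l1normD _ _))// lerD2l.
Qed.

Lemma l1normM z w : l1norm (z * w) <= l1norm z * l1norm w.
Proof.
rewrite /l1norm ReM ImM mulrDl !mulrDr -!normrM.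
apply: le_trans (lerD (ler_normB _ _) (ler_normD _ _)) _.
by rewrite le_eqVlt; apply/orP; left; apply/eqP; ring.
Qed.

Lemma l1norm_mulmx (m n p : nat) (A : 'M[R[i]]_(m, n)) (B : 'M[R[i]]_(n, p))
    (a b : R) :
  (forall i j, l1norm (A i j) <= a) -> (forall i j, l1norm (B i j) <= b) ->
  forall i j, l1norm ((A *m B) i j) <= (n%:R * a) * b.
Proof.
move=> Aa Bb i j; rewrite mxE; apply: le_trans (l1norm_sum _ _) _.
apply: (@le_trans _ _ (\sum_(k < n) a * b)); last first.
  by rewrite sumr_const card_ord -mulrA mulr_natl.
apply: ler_sum => k _; apply: le_trans (l1normM _ _) _.
by apply: ler_pM; rewrite ?l1norm_ge0.
Qed.

Lemma l1norm_mx_le_sum (m n : nat) (A : 'M[R[i]]_(m, n)) i j :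
  l1norm (A i j) <= \sum_k \sum_l l1norm (A k l).
Proof.
rewrite (bigD1 i)//= (bigD1 j)//= -addrA lerDl addr_ge0 ?sumr_ge0//.
  by move=> *; rewrite l1norm_ge0.
by move=> *; apply: sumr_ge0 => *; rewrite l1norm_ge0.
Qed.

Lemma continuous_mx_bounded (m n : nat) (a b : R) (F : R -> 'M[C]_(m, n)) :
  a <= b -> {within `[a, b], continuous F} ->
  exists2 K : R, 0 <= K &
    forall x, x \in `[a, b] -> forall i j, l1norm (F x i j) <= K.
Proof.
move=> ab /within_continuous_mxP Fc.
pose g x := \sum_k \sum_l l1norm (F x k l).
have gc : {within `[a, b], continuous g}.
  apply: continuous_bigsum => k; apply: continuous_bigsum => l x.
  have [/(_ x) cr /(_ x) ci] := Fc k l.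
  by apply: cvgD; apply: cvg_norm.
have [c cab gmax] := EVT_max ab gc; exists (g c).
  by apply: sumr_ge0 => k _; apply: sumr_ge0 => l _; rewrite l1norm_ge0.
by move=> x xab i j; apply: le_trans (gmax _ xab); exact: l1norm_mx_le_sum.
Qed.

(** The segment from 0 to t lies in D, and its interior in the interior of D:
    this is where the uniqueness argument takes place, also when 0 or t is an
    end point of D. *)
Lemma itv_hull0_sub (D : interval R) (t : R) : 0 \in D -> t \in D ->
  `[Num.min 0 t, Num.max 0 t] `<=` [set` D] /\
  `]Num.min 0 t, Num.max 0 t[ `<=` [set` D]^°.
Proof.
move=> D0 Dt.
have sub : `[Num.min 0 t, Num.max 0 t] `<=` [set` D].
  move=> x /=; rewrite in_itv/= => /andP[mx xM].
  have itvD : is_interval [set` D] by exact: interval_is_interval.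
  have [m0|m0] := leP 0 t.
    apply: (itvD 0 t) => //; move: mx xM.
    by rewrite (min_idPl m0) (max_idPr m0) => -> ->.
  apply: (itvD t 0) => //; move: mx xM.
  by rewrite (min_idPr (ltW m0)) (max_idPl (ltW m0)) => -> ->.
split => //; rewrite -open_subsetE; last exact: interval_open.
by apply: subset_trans sub; exact: subset_itv_oo_cc.
Qed.

(** On the segment from 0 to t the coefficient M is bounded, so the real and
    imaginary parts of the entries of E form a finite family to which
    Gronwall's inequality applies. *)
Lemma linear_ode_eq0 (n : nat) (D : interval R) (M E : R -> 'M[C]_n.+1)
    (N : 'M[C]_n.+1) :
  0 \in D -> {within [set` D], continuous M} ->
  {within [set` D], continuous E} -> E 0 = 0 ->
  (forall t, [set` D]^° t -> mxderive E t (M t *m E t + E t *m N)) ->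
  forall t, t \in D -> E t = 0.
Proof.
move=> D0 Mc Ec E0 dE t Dt.
have [subc subo] := itv_hull0_sub D0 Dt.
set a := Num.min 0 t in subc subo *; set b := Num.max 0 t in subc subo *.
have ab : a <= b by rewrite /a /b ge_min !le_max lexx.
have [K K0 MK] := continuous_mx_bounded ab (continuous_subspaceW subc Mc).
have /within_continuous_mxP Ec' := continuous_subspaceW subc Ec.
pose f (k : 'I_n.+1 * 'I_n.+1 * bool) s :=
  if k.2 then Re (E s k.1.1 k.1.2) else Im (E s k.1.1 k.1.2).
pose G s := M s *m E s + E s *m N.
pose df (k : 'I_n.+1 * 'I_n.+1 * bool) s :=
  if k.2 then Re (G s k.1.1 k.1.2) else Im (G s k.1.1 k.1.2).
pose KN := \sum_k \sum_l l1norm (N k l).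
have KN0 : 0 <= KN.
  by apply: sumr_ge0 => k _; apply: sumr_ge0 => l _; rewrite l1norm_ge0.
have fS s : \sum_j `|f j s| = \sum_k \sum_l l1norm (E s k l).
  rewrite pair_bigA /=.
  rewrite -(pair_bigA _
    (fun (p : 'I_n.+1 * 'I_n.+1) (c : bool) => `|f (p, c) s|)) /=.
  by apply: eq_bigr => -[k l] _; rewrite big_bool.
have f0 k : f k 0 = 0.
  by rewrite /f E0 !mxE; case: (k.2).
suff fk0 k : f k t = 0.
  apply/matrixP => i j; rewrite mxE; apply/eqP; rewrite eq_complex.
  have := fk0 (i, j, true); have := fk0 (i, j, false); rewrite /f /= => -> ->.
  by rewrite !eqxx.
apply: (@gronwall_eq0 _ f df (n.+1%:R * (K + KN)) a b ab) => //.
- by rewrite mulr_ge0// addr_ge0.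
- by case=> [[i j] []]; rewrite /f /=; case: (Ec' i j).
- move=> [[i j] c] x xab.
  by have [] := dE x (subo _ xab) i j; case: c.
- move=> [[i j] c] x xab; rewrite fS.
  apply: (@le_trans _ _ (l1norm (G x i j))).
    by case: c; rewrite /df /l1norm /= ?lerDl ?lerDr.
  rewrite mxE; apply: le_trans (l1normD _ _) _; rewrite mulrDr mulrDl lerD//.
    apply: l1norm_mulmx => // [i' j'|i' j']; last exact: l1norm_mx_le_sum.
    by apply: MK; apply: subset_itv_oo_cc xab.
  rewrite mulrAC; apply: l1norm_mulmx => i' j'; exact: l1norm_mx_le_sum.
- by rewrite /a /b; case: (leP 0 t) => _; [left|right].
- by rewrite in_itv /= /a /b ge_min le_max !lexx !orbT.
Qed.

(** * Calculus rules for matrix-valued functions *)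

Lemma mxderive_near (m n : nat) (F G : R -> 'M[R[i]]_(m, n)) t dF :
  (\forall s \near t, F s = G s) -> mxderive F t dF -> mxderive G t dF.
Proof.
move=> FG dFt i j; apply: cderive_near (dFt i j).
by apply: filterS FG => s ->.
Qed.

Lemma mxderive_unique (m n : nat) (F : R -> 'M[R[i]]_(m, n)) t d d' :
  mxderive F t d -> mxderive F t d' -> d = d'.
Proof.
by move=> Fd Fd'; apply/matrixP => i j; exact: cderive_unique (Fd i j) (Fd' i j).
Qed.

Lemma mxderive_cst (m n : nat) (A : 'M[R[i]]_(m, n)) t : mxderive (fun=> A) t 0.
Proof. by move=> i j; rewrite mxE; exact: cderive_cst. Qed.

Lemma mxderiveD (m n : nat) (F G : R -> 'M[R[i]]_(m, n)) t dF dG :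
  mxderive F t dF -> mxderive G t dG ->
  mxderive (fun s => F s + G s) t (dF + dG).
Proof.
move=> Fd Gd i j; rewrite mxE; under [X in cderive X]eq_fun do rewrite mxE.
exact: cderiveD.
Qed.

Lemma mxderiveM (m n p : nat) (F : R -> 'M[R[i]]_(m, n))
    (G : R -> 'M[R[i]]_(n, p)) t dF dG :
  mxderive F t dF -> mxderive G t dG ->
  mxderive (fun s => F s *m G s) t (dF *m G t + F t *m dG).
Proof.
move=> Fd Gd i j; rewrite !mxE -big_split /=.
under [X in cderive X]eq_fun do rewrite mxE.
by apply: cderive_sum => k; exact: cderiveM.
Qed.

Lemma mxderiveMl (m n p : nat) (A : 'M[R[i]]_(m, n))
    (G : R -> 'M[R[i]]_(n, p)) t dG :
  mxderive G t dG -> mxderive (fun s => A *m G s) t (A *m dG).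
Proof.
by move=> /(mxderiveM (mxderive_cst A t)); rewrite mul0mx add0r.
Qed.

Lemma mxderiveN (m n : nat) (F : R -> 'M[R[i]]_(m, n)) t dF :
  mxderive F t dF -> mxderive (fun s => - F s) t (- dF).
Proof.
move=> /(mxderiveMl (- 1%:M)); rewrite mulNmx mul1mx.
by under [X in mxderive X]eq_fun do rewrite mulNmx mul1mx.
Qed.

Lemma mxderive_sum (I : Type) (r : seq I) (m n : nat)
    (F : I -> R -> 'M[R[i]]_(m, n)) t dF :
  (forall k, mxderive (F k) t (dF k)) ->
  mxderive (fun s => \sum_(k <- r) F k s) t (\sum_(k <- r) dF k).
Proof.
move=> Fd i j; rewrite summxE; under [X in cderive X]eq_fun do rewrite summxE.
by apply: cderive_sum => k; exact: Fd.
Qed.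

Lemma cderivable_prod (I : Type) (r : seq I) (f : I -> R -> R[i]) t :
  (forall k, exists d, cderive (f k) t d) ->
  exists d, cderive (fun s => \prod_(k <- r) f k s) t d.
Proof.
move=> fd; elim: r => [|k r [d IH]].
  by exists 0; under [X in cderive X]eq_fun do rewrite big_nil; exact: cderive_cst.
have [e fe] := fd k; eexists; under [X in cderive X]eq_fun do rewrite big_cons.
exact: cderiveM fe IH.
Qed.

Lemma cderivable_det (n : nat) (F : R -> 'M[R[i]]_n) t :
  (forall i j, exists d, cderive (fun s => F s i j) t d) ->
  exists d, cderive (fun s => \det (F s)) t d.
Proof.
move=> Fd.
have /choice[d dP] : forall p : {perm 'I_n}, exists d,
    cderive (fun s => (-1) ^+ p * \prod_k F s k (p k)) t d.
  move=> p; have [d dP] := @cderivable_prod _ (index_enum 'I_n)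
    (fun k s => F s k (p k)) t (fun k => Fd k (p k)).
  by eexists; apply: cderiveM dP; exact: cderive_cst.
by exists (\sum_p d p); rewrite /determinant; exact: cderive_sum.
Qed.

(** 1/z is the conjugate of z divided by (Re z)^2 + (Im z)^2. *)
Lemma cderivable_inv (f : R -> R[i]) t : f t != 0 ->
  (exists d, cderive f t d) -> exists d, cderive (fun s => (f s)^-1) t d.
Proof.
move=> ft0 [d [fr fi]].
pose q s := Re (f s) * Re (f s) + Im (f s) * Im (f s).
have qd := is_derive1D (is_derive1M fr fr) (is_derive1M fi fi).
have q0 : q t != 0.
  apply: contra ft0; rewrite /q -!expr2 paddr_eq0 ?sqr_ge0// !sqrf_eq0.
  by rewrite eq_complex.
have qv := is_derive1V (f := q) q0 qd.
have rv := is_derive1M fr qv.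
have iv := is_derive1M fi (is_derive1N qv).
eexists (_ +i* _); split.
  apply: is_derive1_ext rv => // s.
  by rewrite /q; case: (f s) => x y /=; rewrite -!expr2.
apply: is_derive1_ext iv => // s.
by rewrite /q; case: (f s) => x y /=; rewrite -!expr2 mulrN.
Qed.

(** Cramer's formula.  Unlike [invmx], which is the identity on singular
    matrices, it is given by one rational expression everywhere, hence
    differentiable along any differentiable path where the determinant does not
    vanish. *)
Definition invmx_formula (n : nat) (A : 'M[R[i]]_n) := (\det A)^-1 *: \adj A.

Lemma invmx_formulaE (n : nat) (A : 'M[R[i]]_n) :
  A \in unitmx -> invmx A = invmx_formula A.
Proof. by move=> Au; rewrite /invmx Au. Qed.

Lemma mxderivable_invmx (n : nat) (F : R -> 'M[R[i]]_n) t dF :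
  F t \in unitmx -> mxderive F t dF ->
  exists d, mxderive (fun s => invmx_formula (F s)) t d.
Proof.
rewrite unitmxE unitfE => Fu Fd.
have [d dP] : exists d, cderive (fun s => (\det (F s))^-1) t d.
  by apply: cderivable_inv => //; apply: cderivable_det => i j; exists (dF i j).
have /choice[e eP] : forall ij : 'I_n * 'I_n, exists e,
    cderive (fun s => (invmx_formula (F s)) ij.1 ij.2) t e.
  move=> [i j].
  suff [e eP] : exists e, cderive
      (fun s => (\det (F s))^-1 * cofactor (F s) j i) t e.
    by exists e; under [X in cderive X]eq_fun do rewrite 2!mxE.
  have [e eP] : exists e, cderive (fun s => cofactor (F s) j i) t e.
    have [e eP] : exists e, cderive (fun s => \det (row' j (col' i (F s)))) t e.
      apply: cderivable_det => k l; exists (dF (lift j k) (lift i l)).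
      by under [X in cderive X]eq_fun do rewrite 2!mxE.
    by eexists; apply: cderiveM eP; exact: cderive_cst.
  by eexists; apply: cderiveM dP eP.
exists (\matrix_(i, j) e (i, j)) => i j; rewrite mxE.
exact: (eP (i, j)).
Qed.

Lemma mxderive_within_continuous (m n : nat) (D : interval R)
    (F : R -> 'M[C]_(m, n)) :
  (forall t, t \in D -> exists dF, mxderive F t dF) ->
  {within [set` D], continuous F}.
Proof.
move=> Fd; apply/within_continuous_mxP => i j.
by split; apply: derivable_within_continuous => t /Fd[dF /(_ i j)[[] ? _ []]].
Qed.

(** * The matrix exponential *)

(** A uniform name for the real and the imaginary part, so that one argument on
    real power series serves both. *)
Definition part (c : bool) (z : R[i]) : R := if c then Re z else Im z.

Lemma partD c z w : part c (z + w) = part c z + part c w.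
Proof. by case: c; [exact: ReD|exact: ImD]. Qed.

Lemma part_real c (x : R) z : part c (x%:C * z) = x * part c z.
Proof. by case: c; rewrite /part ?ReM ?ImM /= mul0r ?subr0 ?addr0. Qed.

Lemma part_sum c (I : Type) (r : seq I) (f : I -> R[i]) :
  part c (\sum_(i <- r) f i) = \sum_(i <- r) part c (f i).
Proof.
elim: r => [|i r IH]; first by rewrite !big_nil; case: c.
by rewrite !big_cons partD IH.
Qed.

Lemma ler_part c z : `|part c z| <= l1norm z.
Proof. by case: c; rewrite /l1norm /part ?lerDl ?lerDr. Qed.

Section Exponential.
Variables (n : nat) (M : 'M[R[i]]_n.+1).
Implicit Types (B : 'M[R[i]]_n.+1) (t : R).

(** Each entry of B exp(t M) is, part by part, a real power series in t with
    these coefficients. *)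
Definition expmx_coef B (i j : 'I_n.+1) (c : bool) (k : nat) : R :=
  part c ((B *m M ^+ k) i j) / k`!%:R.

(** Differentiating the power series termwise replaces B by B M; iterating
    keeps the coefficients in the same family, which is why B is kept
    general. *)
Lemma pseries_diffs_expmx_coef B i j c :
  pseries_diffs (expmx_coef B i j c) = expmx_coef (B *m M) i j c.
Proof.
apply/funext => k; rewrite /pseries_diffs /expmx_coef factS natrM.
rewrite exprS -[M * _]/(M *m _) mulmxA.
by field; rewrite nat1r !pnatr_eq0 -lt0n fact_gt0.
Qed.

(** The entries of M^k are bounded by rho^k, so the series is dominated by a
    multiple of the exponential series at rho |t|. *)
Lemma is_cvg_pseries_expmx_coef B i j c t :
  cvgn (pseries (expmx_coef B i j c) t).
Proof.
pose a := \sum_k \sum_l l1norm (M k l).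
pose b := \sum_k \sum_l l1norm (B k l).
pose rho := n.+1%:R * a.
have a0 : 0 <= a.
  by apply: sumr_ge0 => k _; apply: sumr_ge0 => l _; rewrite l1norm_ge0.
have rho0 : 0 <= rho by rewrite mulr_ge0.
have Mk k p q : l1norm ((M ^+ k) p q) <= rho ^+ k.
  elim: k p q => [|k IH] p q.
    rewrite expr0 mxE expr0; case: (p == q);
      by rewrite /l1norm /= !(normr0, normr1) addr0 ?ler01.
  by rewrite !exprS; apply: l1norm_mulmx => // *; exact: l1norm_mx_le_sum.
apply: normed_cvg.
apply: (@series_le_cvg _ _ ((n.+1%:R * b) *: exp_coeff (rho * `|t|))).
- by move=> k /=.
- move=> k; rewrite /GRing.scale /= /GRing.scale /=.
  rewrite mulr_ge0 ?divr_ge0 ?exprn_ge0 ?mulr_ge0//.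
  by apply: sumr_ge0 => ? _; apply: sumr_ge0 => ? _; rewrite l1norm_ge0.
- move=> k; rewrite /= /expmx_coef /GRing.scale /= /GRing.scale /= !normrM normrX.
  rewrite /exp_coeff /= exprMn normfV normr_nat !mulrA -!(mulrAC _ _ (`|t| ^+ k)).
  rewrite ler_wpM2r ?exprn_ge0// ler_wpM2r ?invr_ge0//.
  apply: le_trans (ler_part _ _) _.
  by apply: l1norm_mulmx; [exact: l1norm_mx_le_sum|exact: Mk].
- by apply: is_cvg_seriesZ; exact: is_cvg_series_exp_coeff.
Qed.

Definition expmx_psum (t : R) : nat -> 'M[C]_n.+1 :=
  series (fun k : nat => k`!%:R^-1 *: (t%:C *: M) ^+ k).

Lemma part_expmx_psum B i j c t k :
  part c ((B *m expmx_psum t k) i j) = pseries (expmx_coef B i j c) t k.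
Proof.
rewrite /expmx_psum /pseries /series /= mulmx_sumr summxE part_sum.
apply: eq_bigr => l _; rewrite exprZn scalerA -scalemxAr mxE.
rewrite -(rmorph_nat (real_complex R)) -fmorphV -rmorphXn -rmorphM part_real.
by rewrite /expmx_coef; ring.
Qed.

Definition expmx_lim B t : 'M[C]_n.+1 := \matrix_(i, j)
  (limn (pseries (expmx_coef B i j true) t) +i*
   limn (pseries (expmx_coef B i j false) t)).

Lemma cvg_mul_expmx_psum B t :
  (fun k => B *m expmx_psum t k) @ \oo --> expmx_lim B t.
Proof.
apply/cvg_complex_mxP => i j; rewrite mxE /=; split.
  rewrite -[X in X @ _](_ : pseries (expmx_coef B i j true) t = _).
    exact: is_cvg_pseries_expmx_coef.
  by apply/funext => k; rewrite -part_expmx_psum.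
rewrite -[X in X @ _](_ : pseries (expmx_coef B i j false) t = _).
  exact: is_cvg_pseries_expmx_coef.
by apply/funext => k; rewrite -part_expmx_psum.
Qed.

Lemma cvg_expmx t : expmx_psum t @ \oo --> (expmx (t%:C *: M) : 'M[C]_n.+1).
Proof.
have := @cvg_mul_expmx_psum 1%:M t; under eq_fun do rewrite mul1mx.
by move=> h; rewrite /expmx; apply/cvg_ex; exists (expmx_lim 1%:M t).
Qed.

Lemma expmx_limE B t : expmx_lim B t = B *m expmx (t%:C *: M).
Proof.
apply: (cvg_unique (@norm_hausdorff _ _) (@cvg_mul_expmx_psum B t)).
by apply: cvg_mulmx; [exact: cvg_cst|exact: (@cvg_expmx t)].
Qed.

Lemma expmx_commute t : M *m expmx (t%:C *: M) = expmx (t%:C *: M) *m M.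
Proof.
have MS k : M *m expmx_psum t k = expmx_psum t k *m M.
  rewrite /expmx_psum /series /= mulmx_sumr mulmx_suml; apply: eq_bigr => l _.
  rewrite exprZn -scalemxAr -scalemxAl; congr (_ *: _).
  rewrite -scalemxAr -scalemxAl; congr (_ *: _).
  exact: (commrX l (commr_refl M)).
have hl : (fun k => M *m expmx_psum t k) @ \oo -->
    (M *m expmx (t%:C *: M) : 'M[C]_n.+1).
  by apply: cvg_mulmx; [exact: cvg_cst|exact: (@cvg_expmx t)].
have hr : (fun k => M *m expmx_psum t k) @ \oo -->
    (expmx (t%:C *: M) *m M : 'M[C]_n.+1).
  under eq_fun do rewrite MS.
  by apply: cvg_mulmx; [exact: (@cvg_expmx t)|exact: cvg_cst].
exact: (cvg_unique (@norm_hausdorff _ _) hl hr).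
Qed.

Lemma expmx0 : expmx ((0 : R)%:C *: M) = 1%:M.
Proof.
apply: (cvg_unique (@norm_hausdorff _ _) (@cvg_expmx 0)).
(* every partial sum but the empty one is 1 *)
apply: cvg_near_cst; exists 1%N => // k /= k1.
rewrite /expmx_psum /series /= big_ltn// big_nat_cond big1 ?addr0.
  by rewrite fact0 invr1 expr0 scale1r.
by move=> l /andP[/andP[l1 _] _]; rewrite scale0r expr0n gtn_eqF// scaler0.
Qed.

Lemma mxderive_expmx t :
  mxderive (fun s => expmx (s%:C *: M)) t (M *m expmx (t%:C *: M)).
Proof.
move=> i j.
have D B c : is_derive t 1 (fun s => limn (pseries (expmx_coef B i j c) s))
    (limn (pseries (expmx_coef (B *m M) i j c) t)).
  rewrite -pseries_diffs_expmx_coef.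
  (* any radius larger than |t| would do *)
  apply: (@pseries_snd_diffs _ _ (`|t| + 1)).
  - exact: is_cvg_pseries_expmx_coef.
  - by rewrite pseries_diffs_expmx_coef; exact: is_cvg_pseries_expmx_coef.
  - by rewrite !pseries_diffs_expmx_coef; exact: is_cvg_pseries_expmx_coef.
  - by rewrite [ltRHS]ger0_norm ?addr_ge0// ltrDl.
have E s B : (B *m expmx (s%:C *: M)) i j =
   limn (pseries (expmx_coef B i j true) s) +i*
   limn (pseries (expmx_coef B i j false) s).
  by rewrite -expmx_limE mxE.
have E1 s : expmx (s%:C *: M) i j =
   limn (pseries (expmx_coef 1%:M i j true) s) +i*
   limn (pseries (expmx_coef 1%:M i j false) s).
  by rewrite -[expmx _]mul1mx E.
rewrite -[M in M *m _]mul1mx E.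
split;
  [apply: is_derive1_ext (D 1%:M true)|apply: is_derive1_ext (D 1%:M false)];
  by move=> // s; rewrite E1.
Qed.
End Exponential.
End ComplexAnalysis.

(** * Spectral algebra of the companion matrix *)

(** Lets a matrix of size n.+1 be compared with one whose size is only provably
    equal to n.+1. *)
Lemma char_poly_ext (K : comNzRingType) (m n : nat) (A : 'M[K]_m) (B : 'M[K]_n) :
  m = n ->
  (forall (i j : 'I_m) (i' j' : 'I_n), i = i' :> nat -> j = j' :> nat ->
     A i j = B i' j') ->
  char_poly A = char_poly B.
Proof.
move=> e; subst m => AB; congr char_poly.
by apply/matrixP => i j; exact: AB.
Qed.

Lemma char_poly_companion (K : comNzRingType) (n : nat) (a : n.+1.-tuple K) :
  char_poly (companion a) = 'X^(n.+1) + Poly a.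
Proof.
set p := RHS.
have sa : (size (Poly a) < size ('X^(n.+1) : {poly K}))%N.
  by rewrite size_polyXn ltnS (leq_trans (size_Poly _)) ?size_tuple.
have sp : size p = n.+2 by rewrite /p (size_polyDl sa) size_polyXn.
have pm : p \is monic by rewrite monicE /p (lead_coefDl sa) lead_coefXn.
rewrite -[RHS](companionmxK pm); apply: char_poly_ext; rewrite ?sp//.
move=> i j i' j' ii' jj'.
have di : (size p).-1.-1 = n by rewrite sp.
rewrite !mxE di -(inj_eq val_inj)/= -ii' -jj'.
rewrite [j == _ :> nat]eq_sym; case: ifP => // _.
by rewrite /p coefD coefXn coef_Poly ltn_eqF ?add0r.
Qed.

Section Algebra.
Context {R : realType} {n : nat} (a : n.+1.-tuple R).
Local Notation A := (AC a).
Local Notation J := (altJ R[i] n).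
Local Notation N := (Npoly a).
Local Notation b k := ((a`_k)%:C).

Lemma NpolyE : N = 'X^(n.+1) + map_poly (real_complex R) (Poly a).
Proof.
by rewrite /Npoly /AC -map_char_poly char_poly_companion rmorphD /= map_polyXn.
Qed.

Lemma coef_Npoly k : N`_k = (k == n.+1)%:R + (if (k < n.+1)%N then b k else 0).
Proof.
rewrite NpolyE coefD coefXn coef_map coef_Poly; congr (_ + _).
by case: ltnP => // nk; rewrite nth_default ?size_tuple ?rmorph0.
Qed.

Lemma Npoly_horner w : N.[w] = w ^+ n.+1 + \sum_(k < n.+1) b k * w ^+ k.
Proof.
have -> : N = 'X^(n.+1) + \poly_(k < n.+1) b k.
  by apply/polyP => k; rewrite coef_Npoly coefD coefXn coef_poly.
by rewrite hornerD hornerXn horner_poly.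
Qed.

Lemma AC_xvec w :
  A *m @xvec R n w = w *: @xvec R n w - N.[w] *: delta_mx ord_max 0.
Proof.
apply/matrixP => r c; rewrite !mxE ord1 eqxx andbT.
under eq_bigr do rewrite !mxE.
have [->|rn] := eqVneq r ord_max.
  rewrite Npoly_horner mulr1 -exprS opprD addrA subrr add0r -sumrN.
  by apply: eq_bigr => k _; rewrite rmorphN mulNr.
rewrite mulr0 subr0 -exprS.
have rn' : (r.+1 < n.+1)%N.
  rewrite ltnS ltn_neqAle -ltnS ltn_ord andbT.
  by apply: contra rn => /eqP e; apply/eqP/val_inj.
rewrite (bigD1 (Ordinal rn')) //= eqxx rmorph1 mul1r big1 ?addr0// => k kr.
rewrite (_ : _ == _ = false) ?rmorph0 ?mul0r//.
by apply: contraNF kr => /eqP e; apply/eqP/val_inj.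
Qed.

Lemma altJ_xvec w : J *m @xvec R n w = - @xvec R n (- w).
Proof.
apply/matrixP => r c.
by rewrite mul_diag_mx !mxE [(- w) ^+ _]exprNn exprS mulN1r mulNr.
Qed.

Lemma altJK : J *m J = 1%:M.
Proof.
apply/matrixP => r c; rewrite mul_diag_mx !mxE.
by case: eqP => [->|_]; rewrite ?mulr0n ?mulr0// !mulr1n -expr2 sqrr_sign.
Qed.

Lemma tr_altJ : J^T = J.
Proof. exact: tr_diag_mx. Qed.

(** The Hankel product reindexed: the sum runs over the Hankel entries of row c
    that are not above the antidiagonal, which carry a_0, ..., a_c. *)
Lemma yvecE z (c : 'I_n.+1) : z != 0 ->
  yvec a z c 0 = z ^- c.+1 * \sum_(k < c.+1) b k * z ^+ k.
Proof.
move=> z0; rewrite !mxE.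
have cn : (c <= n)%N by rewrite -ltnS.
rewrite (eq_bigr (fun r : 'I_n.+1 =>
   (if (n - c <= r)%N then b (r - (n - c)) * z ^+ r else 0))); last first.
  move=> r _; rewrite !mxE leq_subLR addnC.
  by case: ifP => // _; rewrite ?rmorph0 ?mul0r// subnBA.
rewrite -big_mkcond /= -(big_mkord (fun r => (n - c <= r)%N)
  (fun r => b (r - (n - c)) * z ^+ r)).
rewrite (big_cat_nat (n := (n - c))) /= ?leqW ?leq_subr//.
rewrite big_nat_cond big1 ?add0r; last first.
  by move=> r /andP[/andP[_ rn]]; rewrite leqNgt rn.
rewrite big_nat_cond (eq_bigl (fun r => (n - c <= r < n.+1)%N)); last first.
  by move=> r; rewrite -andbA; case: (leqP (n - c)) => //=; rewrite andbT.
rewrite -big_nat -{1}[(n - c)%N]add0n big_addn subSn ?leq_subr// subKn//.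
rewrite big_mkord mulr_sumr mulr_sumr; apply: eq_bigr => k _.
have zz (p q : nat) : z ^- (p + q.+1) * z ^+ p = z ^- q.+1.
  by rewrite exprD invfM mulrAC mulVf ?mul1r// expf_neq0.
have := zz (n - c)%N c; rewrite addnS subnK// => <-.
by rewrite addnK exprD; ring.
Qed.

Definition ypoly z : {poly R[i]} := \poly_(k < n.+1) yvec a z (inord k) 0.

(** Comparing coefficients amounts to the recursion
    y_c-1 - z y_c = - a_c, obvious from [yvecE], and to y_n = -1, which is
    N(z) = 0. *)
Lemma ypoly_factor z : z != 0 -> root N z -> ypoly z * ('X - z%:P) = - N.
Proof.
move=> z0 /rootP Nz.
pose S k : R[i] := \sum_(j < k) b j * z ^+ j.
have S_rec k : S k.+1 = S k + b k * z ^+ k by rewrite /S big_ord_recr.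
have Sn : S n.+1 = - z ^+ n.+1.
  by apply/eqP; rewrite -addr_eq0 addrC -Npoly_horner Nz.
have yk k : (ypoly z)`_k = if (k < n.+1)%N then z ^- k.+1 * S k.+1 else 0.
  rewrite coef_poly; case: ltnP => // kn.
  by rewrite yvecE// inordK.
have zz k : z ^- k.+1 * z = z ^- k.
  by rewrite exprSr invfM -mulrA mulVf// mulr1.
apply/polyP => k; rewrite mulrBr coefB coefMX coefMC coefN coef_Npoly !yk.
have zk m : z ^+ m != 0 by rewrite expf_neq0.
case: k => [|k] /=.
  by rewrite mulrAC zz S_rec /S big_ord0 expr0 invr1 mulr1 !add0r mul1r.
rewrite !ltnS eqSS; have [kn|kn|->] := ltngtP k n.
- rewrite mulrAC zz [S k.+2]S_rec mulrDr opprD addrA subrr !add0r.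
  by rewrite mulrCA mulVf ?mulr1.
- by rewrite mul0r subr0 addr0 oppr0.
- by rewrite Sn mulrN mulVf// mul0r subr0 addr0.
Qed.

Lemma ypoly_horner z w : (yvec a z)^T *m @xvec R n w = (ypoly z).[w]%:M.
Proof.
apply/matrixP => r c; rewrite !ord1 !mxE eqxx mulr1n horner_poly.
by apply: eq_bigr => k _; rewrite inord_val !mxE.
Qed.

(** Differentiate the factorization at z. *)
Lemma ypoly_deriv z : z != 0 -> root N z -> (ypoly z).[z] = - N^`().[z].
Proof.
move=> z0 Nz; apply: oppr_inj; rewrite opprK -[N]opprK -(ypoly_factor z0 Nz).
by rewrite derivN derivM derivXsubC mulr1 !hornerE subrr mulr0 add0r.
Qed.

Section Spectrum.
Variable lam : 'I_n.+1 -> R[i].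
Hypothesis Nlam : N = \prod_(i < n.+1) ('X - (lam i)%:P).
Hypothesis lam_inj : injective lam.
Hypothesis lam_sum : forall i j, lam i + lam j != 0.

Local Notation x i := (@xvec R n (lam i)).
Local Notation y i := (yvec a (lam i)).
Local Notation d i := (- N^`().[lam i]).
Local Notation RR i := (residue a (lam i)).
Local Notation P i := (gram_part a (lam i)).
Local Notation Q i := (invgram_part a (lam i)).

Lemma lam_neq0 i : lam i != 0.
Proof. by have := lam_sum i i; rewrite -mulr2n mulrn_eq0. Qed.

Lemma root_lam i : root N (lam i).
Proof. by rewrite Nlam (bigD1 i)//= rootM root_XsubC eqxx. Qed.

Lemma Npoly_opp_neq0 i : N.[- lam i] != 0.
Proof.
rewrite Nlam horner_prod; apply/prodf_neq0 => j _.
by rewrite hornerXsubC -opprD oppr_eq0.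
Qed.

Lemma Npoly_deriv_neq0 i : d i != 0.
Proof.
rewrite -ypoly_deriv ?lam_neq0 ?root_lam//.
have Xi : 'X - (lam i)%:P != 0 by rewrite polyXsubC_eq0.
have -> : ypoly (lam i) = - \prod_(j < n.+1 | j != i) ('X - (lam j)%:P).
  apply: (mulIf Xi); rewrite ypoly_factor ?lam_neq0 ?root_lam//.
  by rewrite mulNr mulrC Nlam (bigD1 i).
rewrite hornerN oppr_eq0 horner_prod; apply/prodf_neq0 => j ji.
by rewrite hornerXsubC subr_eq0 (inj_eq lam_inj) eq_sym.
Qed.

Lemma yvec_xvec i j : (y i)^T *m x j = (if i == j then d i else 0)%:M.
Proof.
rewrite ypoly_horner; congr (_%:M); case: eqVneq => [->|ij].
  by rewrite ypoly_deriv ?lam_neq0 ?root_lam.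
have := ypoly_factor (lam_neq0 i) (root_lam i).
move=> /(congr1 (fun p => p.[lam j])); rewrite hornerM hornerN hornerXsubC.
rewrite (rootP (root_lam j)) oppr0 => /eqP; rewrite mulf_eq0 => /orP[/eqP //|].
by rewrite subr_eq0 (inj_eq lam_inj) eq_sym (negbTE ij).
Qed.

(** The matrices V with columns x_i and W with rows y_i^T / (- N'(l_i)) satisfy
    W V = 1 by orthogonality; the sum of the residues is V W. *)
Lemma sum_residue : \sum_i RR i = 1%:M.
Proof.
pose V : 'M[R[i]]_n.+1 := \matrix_(r, i) x i r 0.
pose W : 'M[R[i]]_n.+1 := \matrix_(i, c) ((d i)^-1 * y i c 0).
have WV : W *m V = 1%:M.
  apply/matrixP => i j.
  transitivity ((d i)^-1 * ((y i)^T *m x j) 0 0).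
    rewrite [LHS]mxE [X in _ * X]mxE mulr_sumr; apply: eq_bigr => k _.
    by rewrite [W _ _]mxE [V _ _]mxE [_^T _ _]mxE mulrA.
  rewrite yvec_xvec !mxE eqxx mulr1n.
  by case: eqP => _; rewrite ?mulr0// mulVf ?Npoly_deriv_neq0.
rewrite -(mulmx1C WV); apply/matrixP => r c; rewrite summxE mxE.
apply: eq_bigr => i _.
rewrite [V _ _]mxE [W _ _]mxE [LHS]mxE [X in _ * X]mxE big_ord1.
by rewrite [_^T _ _]mxE mulrCA.
Qed.

Lemma mul_outer (K : comNzRingType) (m p q : nat) (u : 'cV[K]_m)
    (v w : 'cV[K]_p) (z : 'cV[K]_q) c :
  v^T *m w = c%:M -> (u *m v^T) *m (w *m z^T) = c *: (u *m z^T).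
Proof. by move=> vw; rewrite mulmxA -(mulmxA u) vw mul_mx_scalar scalemxAl. Qed.

Lemma AC_xvec_lam i : A *m x i = lam i *: x i.
Proof. by rewrite AC_xvec (rootP (root_lam i)) scale0r subr0. Qed.

Lemma AC_residue i : A *m RR i = lam i *: RR i.
Proof.
by rewrite /residue -scalemxAr mulmxA AC_xvec_lam -scalemxAl scalerA mulrC -scalerA.
Qed.

Lemma AC_gram_part i : A *m P i = lam i *: P i.
Proof.
rewrite /gram_part -scalemxAr !mulmxA AC_xvec_lam -!scalemxAl.
by rewrite scalerA mulrC -scalerA.
Qed.

Lemma residueM i j : RR i *m RR j = if i == j then RR i else 0.
Proof.
rewrite /residue -scalemxAl -scalemxAr (mul_outer _ _ (yvec_xvec i j)).
case: eqP => [->|_]; last by rewrite scale0r !scaler0.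
by rewrite !scalerA mulfVK ?Npoly_deriv_neq0.
Qed.

(** Left eigenvectors come for free: insert the resolution of the identity by
    the residues on the right of A. *)
Lemma residue_AC i : RR i *m A = lam i *: RR i.
Proof.
rewrite -[A in LHS]mulmx1 -sum_residue !mulmx_sumr.
under eq_bigr do rewrite AC_residue -scalemxAr residueM.
rewrite (bigD1 i)//= eqxx big1 ?addr0// => j ji.
by rewrite eq_sym (negbTE ji) scaler0.
Qed.

Lemma tr_residue_AC i : A^T *m (RR i)^T = lam i *: (RR i)^T.
Proof. by rewrite -trmx_mul residue_AC linearZ. Qed.

Lemma residue_last i :
  RR i *m eeT = (- (d i)^-1) *: (x i *m (delta_mx ord_max 0)^T).
Proof.
rewrite /residue /eeT -scalemxAl.
have ye : (y i)^T *m delta_mx ord_max 0 = (-1)%:M.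
  apply/matrixP => r c; rewrite !ord1 mxE (bigD1 ord_max)//= big1 => [|k kn].
    rewrite [_^T _ _]mxE yvecE ?lam_neq0// [delta_mx _ _ _ _]mxE [RHS]mxE.
    rewrite !eqxx mulr1n mulr1 addr0.
    have := Npoly_horner (lam i); rewrite (rootP (root_lam i)) addrC => /esym/eqP.
    by rewrite addr_eq0 => /eqP ->; rewrite mulrN mulVf ?expf_neq0 ?lam_neq0.
  by rewrite [X in _ * X]mxE (negbTE kn) mulr0.
by rewrite (mul_outer _ _ ye) scalerA mulrN1.
Qed.

(** J turns x(l_i) into - x(- l_i), which is not an eigenvector; the defect
    N(- l_i) e_n cancels the factor N(- l_i) in the denominator. *)
Lemma gram_part_AC i :
  P i *m A^T = - (lam i *: P i) + (d i)^-1 *: (x i *m (delta_mx ord_max 0)^T).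
Proof.
have xJA : A *m (J *m x i) =
    - (lam i *: (J *m x i)) + N.[- lam i] *: delta_mx ord_max 0.
  by rewrite altJ_xvec mulmxN AC_xvec scaleNr scalerN !opprD !opprK.
have {}xJA : (x i)^T *m J *m A^T =
    - (lam i *: ((x i)^T *m J)) + N.[- lam i] *: (delta_mx ord_max 0)^T.
  have := congr1 trmx xJA; rewrite !trmx_mul tr_altJ => ->.
  by rewrite linearD linearN !linearZ /= trmx_mul tr_altJ.
rewrite /gram_part -scalemxAl -!mulmxA [_ *m (J *m A^T)]mulmxA xJA.
rewrite mulmxDr mulmxN -!scalemxAr scalerDr scalerN !scalerA.
congr (- _ + _); first by rewrite mulrC.
by rewrite invfM mulfVK ?Npoly_opp_neq0.
Qed.

Lemma lyapunov_sum_gram : A *m (\sum_i P i) + (\sum_i P i) *m A^T = - eeT.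
Proof.
rewrite mulmx_sumr mulmx_suml -big_split /=.
rewrite -[eeT]mul1mx -sum_residue mulmx_suml -sumrN; apply: eq_bigr => i _.
by rewrite AC_gram_part gram_part_AC addrA subrr add0r residue_last scaleNr opprK.
Qed.

(** R_i (A X + X A^T) R_j^T is R_i X R_j^T multiplied by l_i + l_j. *)
Lemma sylvester_eq0 (X : 'M[R[i]]_n.+1) : A *m X + X *m A^T = 0 -> X = 0.
Proof.
move=> AX; rewrite -[X]mul1mx -[X]mulmx1 -[in X in _ *m (_ *m X)]trmx1 -sum_residue.
rewrite linear_sum /= mulmx_suml big1// => i _; rewrite !mulmx_sumr big1// => j _.
have eA : RR i *m (A *m X) = lam i *: (RR i *m X).
  by rewrite mulmxA residue_AC scalemxAl.
have eAT : X *m A^T *m (RR j)^T = lam j *: (X *m (RR j)^T).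
  by rewrite -mulmxA tr_residue_AC scalemxAr.
have : RR i *m (A *m X + X *m A^T) *m (RR j)^T = 0 by rewrite AX mulmx0 mul0mx.
rewrite mulmxDr mulmxDl eA -[X in _ + X]mulmxA eAT -scalemxAl -scalemxAr -mulmxA.
by rewrite -scalerDl => /eqP; rewrite scaler_eq0 (negbTE (lam_sum _ _)) => /eqP.
Qed.

Lemma sum_tr_residue : \sum_i (RR i)^T = 1%:M.
Proof. by rewrite -[RHS]trmx1 -sum_residue linear_sum. Qed.

Lemma tr_residue i : (RR i)^T = (d i)^-1 *: (y i *m (x i)^T).
Proof. by rewrite /residue linearZ /= trmx_mul trmxK. Qed.

Lemma invgram_gram_part i : (\sum_j Q j) *m P i = J *m (RR i)^T *m J.
Proof.
rewrite mulmx_suml (bigD1 i)//= big1 => [|j ji].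
  rewrite addr0 /invgram_part /gram_part -scalemxAl -scalemxAr mulmxA.
  rewrite (mul_outer _ _ (yvec_xvec i i)) eqxx tr_residue.
  (* abstracted because [yvec] is itself a scaled product, out of which the next
     rewriting would pull the scalar *)
  move: (y i) => yi.
  rewrite -!scalemxAr -!scalemxAl !scalerA -!mulmxA; congr (_ *: _).
  move: (d i) (N.[- lam i]) (Npoly_deriv_neq0 i) (Npoly_opp_neq0 i) => u v u0 v0.
  by field; rewrite u0 v0.
rewrite /invgram_part /gram_part -scalemxAl -scalemxAr mulmxA.
by rewrite (mul_outer _ _ (yvec_xvec j i)) (negbTE ji) scale0r mul0mx !scaler0.
Qed.

Lemma invgram_residue i : (\sum_j Q j) *m RR i = Q i.
Proof.
rewrite mulmx_suml (bigD1 i)//= big1 => [|j ji].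
  rewrite addr0 /invgram_part /residue -scalemxAl -scalemxAr.
  rewrite (mul_outer _ _ (yvec_xvec i i)) eqxx !scalerA; congr (_ *: _).
  by rewrite mulfVK ?Npoly_deriv_neq0.
rewrite /invgram_part /residue -scalemxAl -scalemxAr.
by rewrite (mul_outer _ _ (yvec_xvec j i)) (negbTE ji) scale0r !scaler0.
Qed.

Lemma invgram_gram : (\sum_j Q j) *m (\sum_i P i) = 1%:M.
Proof.
rewrite mulmx_sumr; under eq_bigr do rewrite invgram_gram_part.
by rewrite -mulmx_suml -mulmx_sumr sum_tr_residue mulmx1 altJK.
Qed.
End Spectrum.
End Algebra.

(** * Flows of Sylvester type *)

Section Ode.
Context {R : realType} {n : nat}.
Local Notation C := (R[i] : numFieldType).
Implicit Types (D : interval R) (X : 'M[R[i]]_n.+1).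

Lemma solves_odeP D (E : 'M[R[i]]_n.+1 -> 'M[R[i]]_n.+1 -> Prop)
    (F : R -> 'M[R[i]]_n.+1) :
  solves_ode D E F <->
  {within [set` D], continuous (F : R -> 'M[C]_n.+1)} /\
  forall t : R, [set` D]^° t -> exists2 dF, mxderive F t dF & E (F t) dF.
Proof.
by split=> -[Fc Fd]; split=> // t /Fd[dF ? ?]; exists dF => //; apply/is_mx_deriveP.
Qed.

Lemma within_continuous_mulmx D (F G : R -> 'M[C]_n.+1) :
  {within [set` D], continuous F} -> {within [set` D], continuous G} ->
  {within [set` D], continuous (fun t => F t *m G t)}.
Proof. by move=> Fc Gc t; apply: cvg_mulmx; [exact: Fc|exact: Gc]. Qed.

Lemma within_continuousB_mx D (F G : R -> 'M[C]_n.+1) :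
  {within [set` D], continuous F} -> {within [set` D], continuous G} ->
  {within [set` D], continuous (fun t => F t - G t)}.
Proof. by move=> Fc Gc t; apply: cvgB; [exact: Fc|exact: Gc]. Qed.

Lemma within_continuous_cst_mx D X :
  {within [set` D], continuous (fun=> X : 'M[C]_n.+1)}.
Proof. by move=> t; exact: cvg_cst. Qed.

Lemma within_eq_continuous_mx D (F G : R -> 'M[C]_n.+1) :
  (forall t, t \in D -> F t = G t) -> {within [set` D], continuous F} ->
  {within [set` D], continuous G}.
Proof.
move=> FG; apply: subspace_eq_continuous => t; rewrite inE => /= tD.
exact: (FG t tD).
Qed.

Lemma interior_itv_near D (t : R) : [set` D]^° t -> \forall s \near t, s \in D.
Proof. by []. Qed.

Lemma interior_itv_in D (t : R) : [set` D]^° t -> t \in D.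
Proof. by move=> /interior_itv_near /nbhs_singleton. Qed.

Lemma eigen_conj_involution (V B X : 'M[R[i]]_n.+1) (z : R[i]) :
  V *m V = 1%:M -> B *m X = z *: X ->
  V *m B *m V *m (V *m X *m V) = z *: (V *m X *m V).
Proof.
move=> VV BX; rewrite -!mulmxA (mulmxA V V) VV mul1mx (mulmxA B) BX.
by rewrite -scalemxAl -scalemxAr.
Qed.

(** The scalar l_i inside the exponent acts like L on the left, because the
    columns of S_i lie in the eigenspace of L for l_i. *)
Lemma mxderive_eigen_sum (lam : 'I_n.+1 -> R[i]) (L B : 'M[R[i]]_n.+1)
    (S : 'I_n.+1 -> 'M[R[i]]_n.+1) (t : R) :
  (forall i, L *m S i = lam i *: S i) ->
  let F s := \sum_i S i *m expmx (s%:C *: ((lam i)%:M + B)) in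
  mxderive F t (L *m F t + F t *m B).
Proof.
move=> LS F.
have -> : L *m F t + F t *m B =
    \sum_i S i *m (((lam i)%:M + B) *m expmx (t%:C *: ((lam i)%:M + B))).
  rewrite /F mulmx_sumr mulmx_suml -big_split /=; apply: eq_bigr => i _.
  have := expmx_commute ((lam i)%:M + B) t; move: (expmx _) => X ->.
  by rewrite !mulmxDr mul_mx_scalar -scalemxAr scalemxAl -LS !mulmxA.
by apply: mxderive_sum => i; apply: mxderiveMl; exact: mxderive_expmx.
Qed.

Lemma mxderive_mul_expmx (L B : 'M[R[i]]_n.+1) (t : R) :
  let F (s : R) := expmx (s%:C *: L) *m expmx (s%:C *: B) in
  mxderive F t (L *m F t + F t *m B).
Proof.
move=> F.
have -> : L *m F t + F t *m B = L *m expmx (t%:C *: L) *m expmx (t%:C *: B)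
    + expmx (t%:C *: L) *m (B *m expmx (t%:C *: B)).
  rewrite /F; have := expmx_commute B t.
  by move: (expmx _) (expmx _) => X Y ->; rewrite !mulmxA.
exact: (mxderiveM (mxderive_expmx L t) (mxderive_expmx B t)).
Qed.

Lemma sylvester_flow_unique D (F G : R -> 'M[R[i]]_n.+1) (L B : 'M[R[i]]_n.+1) :
  0 \in D ->
  {within [set` D], continuous (F : R -> 'M[C]_n.+1)} ->
  {within [set` D], continuous (G : R -> 'M[C]_n.+1)} ->
  F 0 = G 0 ->
  (forall t, [set` D]^° t -> exists dF dG,
    [/\ mxderive F t dF, mxderive G t dG &
        dF - dG = L *m (F t - G t) + (F t - G t) *m B]) ->
  forall t, t \in D -> F t = G t.
Proof.
move=> D0 Fc Gc FG0 dFG t tD; apply/eqP; rewrite -subr_eq0; apply/eqP.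
pose E s := F s - G s.
have E0 : E 0 = 0 by rewrite /E FG0 subrr.
have dE s : [set` D]^° s -> mxderive E s (L *m E s + E s *m B).
  by move=> /dFG[dF [dG [Fd Gd <-]]]; exact: (mxderiveD Fd (mxderiveN Gd)).
have Lc := @within_continuous_cst_mx D L.
have Ec := within_continuousB_mx Fc Gc.
exact: (linear_ode_eq0 D0 Lc Ec E0 dE tD).
Qed.
End Ode.

(** * The finite Gramian and its inverse *)

Section Gramian.
Context {R : realType} {n : nat} (a : n.+1.-tuple R).
Context (lam : 'I_n.+1 -> R[i]) (P0 : 'M[R[i]]_n.+1).
Hypothesis Nlam : Npoly a = \prod_(i < n.+1) ('X - (lam i)%:P).
Hypothesis lam_inj : injective lam.
Hypothesis lam_sum : forall i j, lam i + lam j != 0.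
Local Notation C := (R[i] : numFieldType).
Local Notation A := (AC a).
Local Notation J := (altJ R[i] n).
Local Notation Pinf := (\sum_i gram_part a (lam i)).
Local Notation Qinf := (\sum_j invgram_part a (lam j)).

Definition gramian (t : R) : 'M[R[i]]_n.+1 :=
  Pinf + \sum_i (residue a (lam i) *m P0 - gram_part a (lam i))
                  *m expmx (t%:C *: ((lam i)%:M + A^T)).

Definition inv_normalizer (t : R) : 'M[R[i]]_n.+1 :=
  1%:M - expmx (t%:C *: (J *m A^T *m J)) *m expmx (t%:C *: A^T)
  + \sum_i invgram_part a (lam i) *m P0
             *m expmx (t%:C *: ((lam i)%:M + A^T)).

Lemma lyapunov_diffE (X dX : 'M[R[i]]_n.+1) :
  lyapunov_diff a X dX <-> dX = A *m X + X *m A^T + eeT.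
Proof.
rewrite /lyapunov_diff -addrA addrC; split=> [/eqP|->].
  by rewrite subr_eq => /eqP ->; rewrite addrAC addNr add0r.
by rewrite opprD addrA subrr add0r.
Qed.

Lemma lyapunov_algP X : lyapunov_alg a X <-> X = Pinf.
Proof.
split=> [X0|->]; last exact: lyapunov_sum_gram.
apply/eqP; rewrite -subr_eq0; apply/eqP.
apply: (sylvester_eq0 (a := a) Nlam lam_inj lam_sum).
have := lyapunov_sum_gram Nlam lam_inj lam_sum; rewrite -X0 => e.
by rewrite mulmxBr mulmxBl addrACA -opprD e subrr.
Qed.

Lemma Pinf_unit : Pinf \in unitmx.
Proof. by have /mulmx1_unit[] := invgram_gram Nlam lam_inj lam_sum. Qed.

Lemma invmx_Pinf : invmx Pinf = Qinf.
Proof.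
by rewrite -[LHS]mul1mx -(invgram_gram Nlam lam_inj lam_sum) mulmxK ?Pinf_unit.
Qed.

(** Multiply the Lyapunov equation by the inverse of X on both sides. *)
Lemma riccati_alg_invmx X :
  X \in unitmx -> lyapunov_alg a X -> riccati_alg a (invmx X).
Proof.
move=> Xu X0; rewrite /riccati_alg -mulNmx -mulmxN -X0 mulmxDr mulmxDl.
move: (invmx X) (mulVmx Xu) (mulmxV Xu) => Y YX XY.
by rewrite -!mulmxA XY mulmx1 [Y *m (X *m _)]mulmxA YX mul1mx.
Qed.

Lemma gramian_derive t :
  mxderive gramian t
    (A *m (gramian t - Pinf) + (gramian t - Pinf) *m A^T).
Proof.
have AS i : A *m (residue a (lam i) *m P0 - gram_part a (lam i)) =
    lam i *: (residue a (lam i) *m P0 - gram_part a (lam i)).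
  by rewrite mulmxBr mulmxA (AC_residue Nlam) AC_gram_part// -scalemxAl scalerBr.
have := mxderiveD (mxderive_cst Pinf t) (mxderive_eigen_sum A^T t AS).
have -> : gramian t - Pinf =
    \sum_i (residue a (lam i) *m P0 - gram_part a (lam i))
      *m expmx (t%:C *: ((lam i)%:M + A^T)) by rewrite /gramian addrC addKr.
by rewrite add0r.
Qed.

Lemma gramian_lyapunov t dP : mxderive gramian t dP ->
  lyapunov_diff a (gramian t) dP.
Proof.
move=> /(mxderive_unique (gramian_derive t)) <-.
have e := lyapunov_sum_gram Nlam lam_inj lam_sum.
rewrite /lyapunov_diff -e mulmxBr mulmxBl opprD !opprB.
by rewrite [X in X + _ = _]addrAC subrK -addrA subrK.
Qed.

Lemma gramian0 : gramian 0 = P0.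
Proof.
rewrite /gramian; under [X in _ + X]eq_bigr do rewrite expmx0 mulmx1.
rewrite sumrB -mulmx_suml (sum_residue Nlam lam_inj lam_sum) mul1mx.
by rewrite addrC subrK.
Qed.

(** Both sides solve F' = J A^T J F + F A^T with F(0) = 1. *)
Lemma conj_expmx_spectral t :
  \sum_i (J *m (residue a (lam i))^T *m J) *m expmx (t%:C *: ((lam i)%:M + A^T))
  = expmx (t%:C *: (J *m A^T *m J)) *m expmx (t%:C *: A^T).
Proof.
have LS i : J *m A^T *m J *m (J *m (residue a (lam i))^T *m J) =
    lam i *: (J *m (residue a (lam i))^T *m J).
  exact: (eigen_conj_involution (altJK (n := n))
    (tr_residue_AC Nlam lam_inj lam_sum i)).
pose F s := \sum_i (J *m (residue a (lam i))^T *m J)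
  *m expmx (s%:C *: ((lam i)%:M + A^T)).
pose G s := expmx (s%:C *: (J *m A^T *m J)) *m expmx (s%:C *: A^T).
have Fd s := mxderive_eigen_sum A^T s LS.
have Gd s := mxderive_mul_expmx (J *m A^T *m J) A^T s.
apply: (@sylvester_flow_unique _ _ `]-oo, +oo[ F G (J *m A^T *m J) A^T);
  rewrite ?in_itv//.
- by apply: mxderive_within_continuous => s _; eexists; exact: Fd.
- by apply: mxderive_within_continuous => s _; eexists; exact: Gd.
- rewrite /F /G !expmx0 mulmx1; under eq_bigr do rewrite expmx0 mulmx1.
  rewrite -mulmx_suml -mulmx_sumr (sum_tr_residue Nlam lam_inj lam_sum).
  by rewrite mulmx1 altJK.
- move=> s _; exists (J *m A^T *m J *m F s + F s *m A^T).
  exists (J *m A^T *m J *m G s + G s *m A^T); split; [exact: Fd|exact: Gd|].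
  by move: (F s) (G s) => X Y; rewrite mulmxBr mulmxBl addrACA -opprD.
Qed.

(** Orthogonality collapses the inverse of the algebraic solution times R_i
    (resp. P_i) to Q_i (resp. J R_i^T J), and the terms J R_i^T J recombine into
    the product of exponentials. *)
Lemma inv_normalizerE t : inv_normalizer t = Qinf *m gramian t.
Proof.
rewrite /gramian mulmxDr (invgram_gram Nlam lam_inj lam_sum) /inv_normalizer.
rewrite -addrA; congr (_ + _); rewrite -conj_expmx_spectral addrC.
rewrite -sumrB mulmx_sumr; apply: eq_bigr => i _.
rewrite [in RHS]mulmxA mulmxBr mulmxA (invgram_residue Nlam)//.
by rewrite (invgram_gram_part Nlam)// mulmxBl.
Qed.

Lemma gramian_unit t : (gramian t \in unitmx) = (inv_normalizer t \in unitmx).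
Proof.
rewrite inv_normalizerE unitmx_mul -invmx_Pinf unitmx_inv.
by rewrite Pinf_unit.
Qed.

Lemma gramian_inv t : gramian t \in unitmx ->
  invmx (gramian t) = invmx (inv_normalizer t) *m Qinf.
Proof.
move=> Pu; have Nu : inv_normalizer t \in unitmx by rewrite -gramian_unit.
move: (inv_normalizer t) (gramian t) Nu Pu (inv_normalizerE t) => X Y Xu Yu XY.
by apply: (can_inj (mulKmx Xu)); rewrite mulKVmx// XY mulmxK.
Qed.

Lemma gramian_continuous (D : interval R) :
  {within [set` D], continuous (gramian : R -> 'M[C]_n.+1)}.
Proof.
by apply: mxderive_within_continuous => s _; eexists; exact: gramian_derive.
Qed.

Lemma lyapunov_diffP (D : interval R) (P : R -> 'M[R[i]]_n.+1) : 0 \in D ->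
  (solves_ode D (lyapunov_diff a) P /\ P 0 = P0) <->
  (forall t, t \in D -> P t = gramian t).
Proof.
move=> D0; split=> [[/solves_odeP[Pc Pd] P00]|PE].
  have Gc := @gramian_continuous D.
  have PG0 : P 0 = gramian 0 by rewrite gramian0.
  apply: (sylvester_flow_unique (L := A) (B := A^T) D0 Pc Gc PG0).
  move=> t /Pd[dP dPt PL]; have Gd := gramian_derive t.
  set dG := (X in mxderive _ _ X) in Gd.
  exists dP, dG; split => //.
  have /lyapunov_diffE -> := gramian_lyapunov Gd; move/lyapunov_diffE: PL => ->.
  move: (gramian t) (P t) => Y X.
  by rewrite mulmxBr mulmxBl opprD addrACA subrr addr0 opprD addrACA.
split; last by rewrite PE// gramian0.
apply/solves_odeP; split.
  apply: (@within_eq_continuous_mx _ _ D gramian P) => [t tD|].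
    by rewrite PE.
  exact: gramian_continuous.
move=> t tD; eexists; last first.
  by rewrite PE ?interior_itv_in//; apply: gramian_lyapunov; exact: gramian_derive.
apply: mxderive_near (gramian_derive t).
by apply: filterS (interior_itv_near tD) => s sD; rewrite PE.
Qed.

Lemma riccati_diffE (Y dY : 'M[R[i]]_n.+1) :
  riccati_diff a Y dY <-> dY = - (Y *m A) - A^T *m Y - Y *m eeT *m Y.
Proof.
rewrite /riccati_diff; move: (Y *m A) (A^T *m Y) (Y *m eeT *m Y) => X1 X2 X3.
split=> [/(canRL (addrK _)) /(canRL (addrK _)) ->|->];
  by apply/matrixP => i j; rewrite !mxE; ring.
Qed.

(** The defect Y X - 1 of a Riccati solution Y from being the inverse of a
    Lyapunov solution X obeys a homogeneous linear equation. *)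
Lemma mul_diff_riccati_lyapunov (X Y dX dY : 'M[R[i]]_n.+1) :
  lyapunov_diff a X dX -> riccati_diff a Y dY ->
  dY *m X + Y *m dX =
    (- A^T - Y *m eeT) *m (Y *m X - 1%:M) + (Y *m X - 1%:M) *m A^T.
Proof.
move=> /lyapunov_diffE -> /riccati_diffE ->; move: A eeT => B U.
rewrite !(mulmxBl, mulmxBr, mulmxDr, mulNmx, mulmxN, mulmxDl, mulmx1, mul1mx).
rewrite !mulmxA.
move: (Y *m B *m X) (B^T *m Y *m X) (Y *m X *m B^T) (Y *m U) => X1 X2 X3 X4.
move: (X4 *m Y *m X) => X5.
by apply/matrixP => i j; rewrite !mxE; ring.
Qed.

Lemma riccati_diff_inverse (X Y dX dY : 'M[R[i]]_n.+1) :
  Y *m X = 1%:M -> lyapunov_diff a X dX -> dY *m X + Y *m dX = 0 ->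
  riccati_diff a Y dY.
Proof.
move=> YX /lyapunov_diffE ->; have XY := mulmx1C YX.
move=> /(congr1 (fun M => M *m Y)); rewrite mul0mx mulmxDl -mulmxA XY mulmx1.
move=> /(canRL (addrK _)) ->; apply/riccati_diffE.
rewrite !mulmxDr !mulmxDl -(mulmxA _ (A *m X) Y) -(mulmxA A) XY mulmx1.
rewrite (mulmxA Y X) YX mul1mx.
move: (Y *m A) (A^T *m Y) (Y *m eeT *m Y) => X1 X2 X3.
by apply/matrixP => i j; rewrite !mxE; ring.
Qed.

(** From left to right the invertibility of the Gramian is a conclusion: it
    follows from Q P_C = 1, which holds because the defect is a solution of a
    homogeneous linear equation vanishing at 0. *)
Lemma riccati_diffP (D : interval R) (Q : R -> 'M[R[i]]_n.+1) : 0 \in D ->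
  (solves_ode D (riccati_diff a) Q /\ Q 0 *m P0 = 1%:M) <->
  (forall t, t \in D -> inv_normalizer t \in unitmx /\
                        Q t = invmx (inv_normalizer t) *m Qinf).
Proof.
move=> D0; have Gc := @gramian_continuous D.
split=> [[/solves_odeP[Qc Qd] Q00]|QE].
  pose E s := Q s *m gramian s - 1%:M.
  suff E0 t : t \in D -> E t = 0.
    move=> t tD; have /eqP := E0 t tD; rewrite subr_eq0 => /eqP QG.
    have [_ Gu] := mulmx1_unit QG.
    rewrite -gramian_unit Gu -gramian_inv//; split=> //.
    by move: (Q t) (gramian t) Gu QG => X Y Yu XY; rewrite -[RHS]mul1mx -XY mulmxK.
  have Mc : {within [set` D], continuous
      ((fun s => - A^T - Q s *m eeT) : R -> 'M[C]_n.+1)}.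
    have Uc := @within_continuous_cst_mx R n D eeT.
    have Ac := @within_continuous_cst_mx R n D (- A^T).
    exact: (within_continuousB_mx Ac (within_continuous_mulmx Qc Uc)).
  have Ec : {within [set` D], continuous (E : R -> 'M[C]_n.+1)}.
    have Ic := @within_continuous_cst_mx R n D 1%:M.
    exact: (within_continuousB_mx (within_continuous_mulmx Qc Gc) Ic).
  have E00 : E 0 = 0 by rewrite /E gramian0 Q00 subrr.
  move=> tD; apply: (linear_ode_eq0 (N := A^T) D0 Mc Ec E00 _ tD) => s /Qd[dQ dQs QR].
  have Gd := gramian_derive s.
  rewrite -(mul_diff_riccati_lyapunov (gramian_lyapunov Gd) QR).
  have := mxderiveD (mxderiveM dQs Gd) (mxderive_cst (- 1%:M) s).
  by rewrite addr0.
pose Y s := invmx_formula (gramian s).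
have Gu s : s \in D -> gramian s \in unitmx.
  by move=> /QE[]; rewrite gramian_unit.
have QY s : s \in D -> Y s = Q s.
  move=> sD; have [_ ->] := QE s sD.
  by rewrite -gramian_inv ?Gu// /Y -invmx_formulaE ?Gu.
have Yd s : s \in D -> exists dY, mxderive Y s dY.
  by move=> sD; apply: mxderivable_invmx (Gu s sD) (gramian_derive s).
have QG s : s \in D -> Q s *m gramian s = 1%:M.
  by move=> sD; rewrite -QY// /Y -invmx_formulaE ?mulVmx ?Gu.
split; last by rewrite -gramian0 QG.
apply/solves_odeP; split.
  have Yc := mxderive_within_continuous Yd.
  exact: (@within_eq_continuous_mx R n D Y Q QY Yc).
move=> t tD; have tD' := interior_itv_in tD.
have [dY Yt] := Yd t tD'; exists dY.
  apply: mxderive_near Yt.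
  by apply: filterS (interior_itv_near tD) => s sD; rewrite QY.
have Gd := gramian_derive t.
apply: (riccati_diff_inverse (QG t tD') (gramian_lyapunov Gd)).
rewrite -QY//; apply: mxderive_unique (mxderiveM Yt Gd) _.
apply: mxderive_near (mxderive_cst 1%:M t).
by apply: filterS (interior_itv_near tD) => s sD; rewrite QY// QG.
Qed.
End Gramian.

Theorem theorem5 (R : realType) (n : nat) (a : n.+1.-tuple R)
  (lam : 'I_n.+1 -> R[i]) (P0 : 'M[R[i]]_n.+1) (D : interval R) :
  char_poly (AC a) = \prod_(i < n.+1) ('X - (lam i)%:P) ->
  injective lam ->
  (forall i j, lam i + lam j != 0) ->
  0 \in D ->
  let A := AC a in
  let J := altJ R[i] n in
  exists2 Pinf : 'M[R[i]]_n.+1,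
    [/\ forall X, lyapunov_alg a X <-> X = Pinf,
        Pinf \in unitmx,
        riccati_alg a (invmx Pinf),
        Pinf = \sum_i gram_part a (lam i) &
        invmx Pinf = \sum_j invgram_part a (lam j)] &
    let Pt (t : R) : 'M[R[i]]_n.+1 :=
      Pinf + \sum_i (residue a (lam i) *m P0 - gram_part a (lam i))
                      *m expmx (t%:C *: ((lam i)%:M + A^T)) in
    (* the exponential in the second term is the ordered product
       e^(J A^T J t) e^(A^T t): its two exponents commute only when n = 0 *)
    let Ginv (t : R) : 'M[R[i]]_n.+1 :=
      1%:M - expmx (t%:C *: (J *m A^T *m J)) *m expmx (t%:C *: A^T)
      + \sum_i invgram_part a (lam i) *m P0
                 *m expmx (t%:C *: ((lam i)%:M + A^T)) in
    let G (t : R) : 'M[R[i]]_n.+1 := invmx (Ginv t) in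
    [/\ (* the solution P_C of the differential Lyapunov equation *)
        forall P : R -> 'M[R[i]]_n.+1,
          (solves_ode D (lyapunov_diff a) P /\ P 0 = P0) <->
          (forall t, t \in D -> P t = Pt t),
        (* its pointwise inverse, wherever it exists *)
        forall t, t \in D ->
          (Pt t \in unitmx) = (Ginv t \in unitmx) /\
          (Pt t \in unitmx ->
           invmx (Pt t) = G t *m \sum_j invgram_part a (lam j)) &
        (* the solution P_C^-1 of the differential Riccati equation *)
        forall Q : R -> 'M[R[i]]_n.+1,
          (solves_ode D (riccati_diff a) Q /\ Q 0 *m P0 = 1%:M) <->
          (forall t, t \in D ->
             Ginv t \in unitmx /\
             Q t = G t *m \sum_j invgram_part a (lam j))].
Proof.
move=> Nlam lam_inj lam_sum D0 A J; exists (\sum_i gram_part a (lam i)).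
  have PL := lyapunov_algP Nlam lam_inj lam_sum.
  have Pu := Pinf_unit Nlam lam_inj lam_sum.
  split=> //; last exact: invmx_Pinf.
  by apply: riccati_alg_invmx => //; apply/PL.
move=> Pt Ginv G; split.
- move=> P; exact: lyapunov_diffP.
- move=> t _; split; first exact: gramian_unit.
  exact: gramian_inv.
- move=> Q; exact: riccati_diffP.
Qed.
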